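(* Let $(R,\mathfrak m)$ be a local Cohen-Macaulay ring and let $I\subseteq R$ be an invertible ideal. There exists a positive integer $a:=a(I)$ with the following property: if $J\subseteq R$ is an ideal such that $R/J$ is Cohen-Macaulay of multiplicity at most the multiplicity of $R/I$, and such that $I+\mathfrak m^a=J+\mathfrak m^a$, then $J$ is invertible.
   Context: Local Cohen-Macaulay rings are Noetherian. An invertible ideal is a principal ideal generated by a non zero-divisor. The multiplicity of a Noetherian local ring is its multiplicity with respect to its maximal ideal. *)

(* Defs.v *)
From HB Require Import structures.
From mathcomp Require Import all_boot all_order all_algebra.
From mathcomp Require Import all_classical all_reals all_analysis.
Import numFieldNormedType.Exports.

Set Implicit Arguments.
Unset Strict Implicit.
Unset Printing Implicit Defensive.

Import Order.TTheory GRing.Theory Num.Theory.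
Local Open Scope classical_set_scope.
Local Open Scope ring_scope.
Local Open Scope quotient_scope.

(* The base structure is comPzRingType, not comNzRingType, because quotients   *)
(* by the unit ideal must be allowed. MathComp's idealr is not used: it only   *)
(* covers proper ideals.                                                       *)

Record is_ideal (R : comPzRingType) (I : set R) : Prop := IsIdeal {
  ideal_0 : I 0;
  ideal_D : forall x y, I x -> I y -> I (x + y);
  ideal_Ml : forall r x, I x -> I (r * x) }.

Record ideal (R : comPzRingType) := Ideal {
  ideal_set :> set R;
  idealP : is_ideal ideal_set }.

Identity Coercion fun_of_set : set >-> Funclass.

Lemma ideal_eq (R : comPzRingType) (I J : ideal R) :
  (I : set R) = J -> I = J.
Proof.
by case: I J => [I pI] [J pJ] /= IJ; subst J; congr Ideal; exact: Prop_irrelevance.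
Qed.

Section IdealOperations.
Variable R : comPzRingType.
Implicit Types (I J : ideal R) (A : set R).

Lemma unit_ideal_subproof : is_ideal [set: R].
Proof. by []. Qed.
Definition unit_ideal : ideal R := Ideal unit_ideal_subproof.

Lemma span_subproof A : is_ideal (smallest (@is_ideal R) A).
Proof.
split=> [|x y hx hy|r x hx] K [idK AK]; first exact: ideal_0.
- by apply: ideal_D => //; [exact: hx | exact: hy].
- by apply: ideal_Ml => //; exact: hx.
Qed.
Definition ideal_span A : ideal R := Ideal (span_subproof A).

Lemma ideal_add_subproof I J :
  is_ideal [set z | exists x y, [/\ I x, J y & z = x + y]].
Proof.
have [I0 ID IM] := idealP I; have [J0 JD JM] := idealP J.
split=> [|_ _ [x [y [Ix Jy ->]]] [x' [y' [Ix' Jy' ->]]]|r _ [x [y [Ix Jy ->]]]].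
- by exists 0, 0; rewrite addr0.
- by exists (x + x'), (y + y'); split; [exact: ID | exact: JD | rewrite addrACA].
- by exists (r * x), (r * y); split; [exact: IM | exact: JM | rewrite mulrDr].
Qed.
Definition ideal_add I J : ideal R := Ideal (ideal_add_subproof I J).

Definition ideal_mul I J : ideal R :=
  ideal_span [set z | exists x y, [/\ I x, J y & z = x * y]].

Definition ideal_exp I n : ideal R := iter n (ideal_mul I) unit_ideal.

Lemma ideal_pred_subproof I : zmod_closed [pred x | x \in (I : set R)].
Proof.
have [I0 ID IM] := idealP I; split=> [|x y]; rewrite !inE //= => Ix Iy.
by apply: ID => //; rewrite -mulN1r; exact: IM.
Qed.
Definition ideal_pred I : {pred R} := [pred x | x \in (I : set R)].
HB.instance Definition _ I :=
  GRing.isZmodClosed.Build R (ideal_pred I) (ideal_pred_subproof I).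

End IdealOperations.

Arguments unit_ideal {R}.

(* MathComp's quotient of additive groups, equipped with its multiplication.   *)
Definition quot_ring (R : comPzRingType) (I : ideal R) : Type :=
  Quotient.quot (ideal_pred I).

Section QuotientRing.
Variables (R : comPzRingType) (I : ideal R).

HB.instance Definition _ := GRing.Zmodule.on (quot_ring I).

Definition quot_pi (x : R) : quot_ring I := \pi_(Quotient.quot (ideal_pred I)) x.

Lemma quot_pi_eq x y : quot_pi x = quot_pi y <-> I (x - y).
Proof.
have eqP' := @eqquotP _ _ (Quotient.quot (ideal_pred I)) x y.
by split=> [/eqP'|Ixy]; [|apply/eqP']; rewrite /Quotient.equiv !inE.
Qed.

Lemma quot_pi_surj (u : quot_ring I) : exists x, quot_pi x = u.
Proof. by exists (repr u); rewrite /quot_pi reprK. Qed.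

Lemma quot_piD x y : quot_pi (x + y) = quot_pi x + quot_pi y.
Proof. exact: (raddfD \pi_(Quotient.quot (ideal_pred I))). Qed.

Definition quot_one : quot_ring I := quot_pi 1.
Definition quot_mul (u v : quot_ring I) : quot_ring I :=
  quot_pi (repr u * repr v).

Lemma quot_piM x y : quot_pi (x * y) = quot_mul (quot_pi x) (quot_pi y).
Proof.
have [_ ID IM] := idealP I.
have H z : I (z - repr (quot_pi z)) by apply/quot_pi_eq; rewrite /quot_pi reprK.
apply/quot_pi_eq; set x' := repr _; set y' := repr _.
have -> : x * y - x' * y' = y * (x - x') + x' * (y - y').
  by rewrite !mulrBr (mulrC y x) (mulrC y x') addrA subrK.
by apply: ID; apply: IM; exact: H.
Qed.

Lemma quot_mulA : associative quot_mul.
Proof.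
move=> u v w; have [x <-] := quot_pi_surj u; have [y <-] := quot_pi_surj v.
by have [z <-] := quot_pi_surj w; rewrite -!quot_piM mulrA.
Qed.

Lemma quot_mulC : commutative quot_mul.
Proof.
move=> u v; have [x <-] := quot_pi_surj u; have [y <-] := quot_pi_surj v.
by rewrite -!quot_piM mulrC.
Qed.

Lemma quot_mul1 : left_id quot_one quot_mul.
Proof. by move=> u; have [x <-] := quot_pi_surj u; rewrite -quot_piM mul1r. Qed.

Lemma quot_mulDl : left_distributive quot_mul +%R.
Proof.
move=> u v w; have [x <-] := quot_pi_surj u; have [y <-] := quot_pi_surj v.
have [z <-] := quot_pi_surj w.
by rewrite -quot_piD -!quot_piM mulrDl quot_piD.
Qed.

HB.instance Definition _ := GRing.Zmodule_isComPzRing.Build (quot_ring I)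
  quot_mulA quot_mulC quot_mul1 quot_mulDl.

Lemma quot_ideal_subproof (J : ideal R) :
  is_ideal [set quot_pi x | x in (J : set R)].
Proof.
have [J0 JD JM] := idealP J; split=> [|_ _ [x Jx <-] [y Jy <-]|u _ [x Jx <-]].
- by exists 0 => //; exact: (raddf0 \pi_(Quotient.quot (ideal_pred I))).
- by exists (x + y); [exact: JD | rewrite quot_piD].
- have [r <-] := quot_pi_surj u.
  by exists (r * x); [exact: JM | rewrite quot_piM].
Qed.

(* The extension J(R/I) = (J + I)/I. *)
Definition quot_ideal (J : ideal R) : ideal (quot_ring I) :=
  Ideal (quot_ideal_subproof J).

End QuotientRing.

Section RingNotions.
Variable R : comPzRingType.
Implicit Types (I J m q : ideal R) (x : R) (s : seq R).

Definition noetherian : Prop :=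
  forall I, exists s, I = ideal_span [set` s].

Definition prime_ideal I : Prop :=
  I <> unit_ideal /\ forall x y, I (x * y) -> I x \/ I y.

Definition maximal_ideal I : Prop :=
  I <> unit_ideal /\
  forall J, (I : set R) `<=` J -> J = I \/ J = unit_ideal.

Definition local_ring m : Prop :=
  maximal_ideal m /\ forall I, maximal_ideal I -> I = m.

Definition nonzerodivisor x : Prop := forall y, x * y = 0 -> y = 0.

Definition invertible_ideal I : Prop :=
  exists2 x, nonzerodivisor x & I = ideal_span [set x].

(* [ideal_chain P n]: there are ideals c 0 < c 1 < ... < c n, all satisfying P. *)
Definition ideal_chain (P : ideal R -> Prop) (n : nat) : Prop :=
  exists c : nat -> ideal R,
    (forall i, (i <= n)%N -> P (c i)) /\
    (forall i, (i < n)%N -> (c i : set R) `<` c i.+1).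

Definition has_krull_dim (d : nat) : Prop :=
  ideal_chain prime_ideal d /\
  forall n, ideal_chain prime_ideal n -> (n <= d)%N.

Definition krull_dim : nat := xget 0%N has_krull_dim.

(* Length of R as a module over itself, whose submodules are the ideals. *)
Definition has_length (l : nat) : Prop :=
  ideal_chain (fun=> True) l /\
  forall n, ideal_chain (fun=> True) n -> (n <= l)%N.

Definition ring_length : nat := xget 0%N has_length.

Definition regular_sequence s : Prop :=
  ideal_span [set` s] <> unit_ideal /\
  forall i, (i < size s)%N -> forall y,
    ideal_span [set` take i s] (s`_i * y) -> ideal_span [set` take i s] y.

Definition has_depth m (d : nat) : Prop :=
  (exists s, [/\ regular_sequence s, [set` s] `<=` m & size s = d]) /\
  forall s, regular_sequence s -> [set` s] `<=` m -> (size s <= d)%N.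

Definition local_cohen_macaulay m : Prop :=
  [/\ noetherian, local_ring m &
      exists2 d, has_krull_dim d & has_depth m d].

End RingNotions.

Arguments noetherian : clear implicits.
Arguments has_krull_dim : clear implicits.
Arguments krull_dim : clear implicits.
Arguments has_length : clear implicits.
Arguments ring_length : clear implicits.

(* Meant for quotients of a local ring, which are local or zero. The zero ring *)
(* is Cohen-Macaulay by convention, like the zero module.                      *)
Definition cohen_macaulay (R : comPzRingType) : Prop :=
  (1 : R) = 0 \/ exists m : ideal R, local_cohen_macaulay m.

(* e(q) = lim_n d! l(R/q^n) / n^d with d = dim R. The values converge, to an   *)
(* integer, when q is the maximal ideal of a Noetherian local ring; the value  *)
(* is 0 for the zero ring.                                                     *)
Definition multiplicity (R : comPzRingType) (q : ideal R) : rat :=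
  let d := krull_dim R in
  limn (fun n => (d`! * ring_length (quot_ring (ideal_exp q n)))%:R / n%:R ^+ d
                 : rat^o).

(* Main.v *)
(* Write I = (x); only the case x in m is interesting. Let N = dim R/I, and let     *)
(* q = (x_1, ..., x_N) be generated by a system of parameters of R/I. If J and I    *)
(* agree modulo a high power m^a, some y in J is close to x, and Nakayama's lemma    *)
(* gives I + q = J + q = (y) + q. If depth R/J >= N, then x_1, ..., x_N is regular   *)
(* modulo J, which forces J = (y), and y is a nonzerodivisor because y, x_1, ...,    *)
(* x_N is a system of parameters of R. To exclude d = dim R/J < N, compare lengths:  *)
(* as R/J is Cohen-Macaulay, l(R/(J + m^(n+1))) <= e(R/J) C(n+d, d), whereas         *)
(* l(R/(I + m^n)) grows like n^N; both lengths agree for n <= a.                     *)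
(* The bound on lengths uses a reduction of m generated by d elements modulo J. It  *)
(* exists after replacing R by R[T] localized at m[T], which makes the residue field *)
(* infinite and provides generic elements, so prime avoidance is not needed.         *)

(* Let I = (x) with x in m and dim R = N + 1. The proof compares depth, which makes parameters
   regular, with dimension, which bounds growth. If J has depth at least N and m^r lies in J + (s)
   for a list s of N elements of m, then s is regular modulo J ([sop_regular]), and the length
   modulo J + (s)^(n+1) is that modulo J + (s) times C(n + N, N) ([sop_length]). If R/K has
   dimension n, then m has modulo K a reduction by n elements in an extension ([growth_dim],
   [reduction_exists]), so m^(i+c) lies in K + (s)^i for a fixed c.

   If R/J has depth at least N, [approximation_principal] gives J = (y) with y regular. If its
   dimension is d < N, [multiplicity_cm] bounds its lengths by a polynomial of degree d whose
   leading coefficient is controlled by the multiplicity, while [length_lower] gives growth of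
   degree N for R/I. By [binomial_growth_gap] the two disagree at an exponent that depends only on
   N, c and a bound for the multiplicity of R/I.

   All arguments may pass to a [good_ext] A -> B: it is flat on colon ideals, mB is the maximal
   ideal, lengths and regular sequences are preserved, membership descends. The extension A(T) of
   [generic_ext] supplies generic elements. Depth is defined up to such extensions; [depth_exchange]
   shows that a regular element of m lowers it by at most one, and [depth_annihilator] that it
   bounds the dimension of associated primes. *)
From HB Require Import structures.
From mathcomp Require Import all_boot all_order all_algebra.
From mathcomp Require Import all_classical all_reals all_analysis.
From mathcomp Require Import zify ring.
Import numFieldNormedType.Exports.
Require Import Defs.

Set Implicit Arguments.
Unset Strict Implicit.
Unset Printing Implicit Defensive.

Import Order.TTheory GRing.Theory Num.Theory.
Local Open Scope classical_set_scope.
Local Open Scope ring_scope.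
Local Open Scope quotient_scope.

(** * The semiring of ideals *)

Notation "I <<= K" := (ideal_set I%R `<=` ideal_set K%R) (at level 70, no associativity).
Notation "z \ini I" := (ideal_set I%R z) (at level 70, no associativity).

#[global] Arguments ideal_set : simpl never.

Section IdealSemiring.
Variable R : comPzRingType.
Implicit Types (I J K L : ideal R) (x y z : R) (s : seq R).

Lemma ideal_le_anti I J : I <<= J -> J <<= I -> I = J.
Proof. by move=> IJ JI; apply: ideal_eq; rewrite eqEsubset. Qed.

Lemma idealN I x : I x -> I (- x).
Proof. by move=> Ix; rewrite -mulN1r; apply: (ideal_Ml (idealP I)). Qed.

Lemma idealB I x y : I x -> I y -> I (x - y).
Proof. by move=> Ix Iy; apply: (ideal_D (idealP I)) => //; exact: idealN. Qed.

Lemma idealMr I x y : I x -> I (x * y).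
Proof. by rewrite mulrC; apply: (ideal_Ml (idealP I)). Qed.

Lemma idealMl I x y : I x -> I (y * x).
Proof. exact: (ideal_Ml (idealP I)). Qed.

Lemma ideal_sum I (T : Type) (r : seq T) (P : pred T) (F : T -> R) :
  (forall i, P i -> I (F i)) -> I (\sum_(i <- r | P i) F i).
Proof.
by move=> IF; apply: (big_ind I) => //; [exact: ideal_0 (idealP I)|exact: ideal_D (idealP I)].
Qed.

Lemma span_le (A : set R) K : A `<=` K -> ideal_span A <<= K.
Proof. by move=> AK x; apply; split=> //; exact: idealP. Qed.

Lemma span_mem (A : set R) x : A x -> ideal_span A x.
Proof. by move=> Ax K [_]; apply. Qed.

Lemma ideal_add_le I J K : I <<= K -> J <<= K -> ideal_add I J <<= K.
Proof. by move=> IK JK _ [x [y [/IK Kx /JK Ky ->]]]; exact: (ideal_D (idealP K)). Qed.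

Lemma ideal_addl I J : I <<= ideal_add I J.
Proof. by move=> x Ix; exists x, 0; split=> //; [exact: (ideal_0 (idealP J))|rewrite addr0]. Qed.

Lemma ideal_addr I J : J <<= ideal_add I J.
Proof. by move=> x Ix; exists 0, x; split=> //; [exact: (ideal_0 (idealP I))|rewrite add0r]. Qed.

Lemma ideal_mul_mem I J x y : I x -> J y -> ideal_mul I J (x * y).
Proof. by move=> Ix Jy; apply: span_mem; exists x, y. Qed.

(** A condition on products becomes an inclusion into a colon ideal, which can be tested on
    generators. *)
Definition ideal_colon_set I (A : set R) : set R := [set y | forall a, A a -> I (a * y)].
Lemma ideal_colon_subproof I A : is_ideal (ideal_colon_set I A).
Proof.
split=> [a _|x y Ix Iy a Aa|r x Ix a Aa].
- by rewrite mulr0; exact: (ideal_0 (idealP I)).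
- by rewrite mulrDr; apply: (ideal_D (idealP I)); [exact: Ix|exact: Iy].
- by rewrite mulrCA; apply: idealMl; exact: Ix.
Qed.
Definition colon I A : ideal R := Ideal (ideal_colon_subproof I A).

Lemma ideal_mul_le I J K : (forall x y, I x -> J y -> K (x * y)) -> ideal_mul I J <<= K.
Proof. by move=> h; apply: span_le => _ [x [y [Ix Jy ->]]]; exact: h. Qed.

Lemma ideal_mulC : commutative (@ideal_mul R).
Proof.
move=> I J; apply: ideal_le_anti; apply: ideal_mul_le => x y Ix Jy;
 by rewrite mulrC; exact: ideal_mul_mem.
Qed.

Lemma ideal_mul_leA I J K : ideal_mul (ideal_mul I J) K <<= ideal_mul I (ideal_mul J K).
Proof.
apply: ideal_mul_le => x y IJx Ky; rewrite mulrC.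
suff /(_ x IJx y): ideal_mul I J <<= colon (ideal_mul I (ideal_mul J K)) K by exact.
apply: ideal_mul_le => u v Iu Jv k Kk; rewrite mulrC -mulrA.
by apply: ideal_mul_mem => //; exact: ideal_mul_mem.
Qed.

Lemma ideal_mulA : associative (@ideal_mul R).
Proof.
move=> I J K; apply: ideal_le_anti; last exact: ideal_mul_leA.
rewrite ideal_mulC (ideal_mulC J) (ideal_mulC _ K) (ideal_mulC I J).
exact: ideal_mul_leA.
Qed.

Lemma ideal_mul1 : left_id (@unit_ideal R) (@ideal_mul R).
Proof.
move=> I; apply: ideal_le_anti; first by apply: ideal_mul_le => x y _; exact: idealMl.
by move=> x Ix; rewrite -[x]mul1r; exact: ideal_mul_mem.
Qed.

Lemma ideal_addC : commutative (@ideal_add R).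
Proof.
by move=> I J; apply: ideal_le_anti; apply: ideal_add_le; (exact: ideal_addl || exact: ideal_addr).
Qed.

Lemma ideal_addA : associative (@ideal_add R).
Proof.
move=> I J K; apply: ideal_le_anti => x.
  by move=> [u [_ [Iu [v [w [Jv Kw ->]]] ->]]]; exists (u + v), w; split; rewrite ?addrA//; exists u, v.
by move=> [_ [w [[u [v [Iu Jv ->]]] Kw ->]]]; exists u, (v + w); split; rewrite ?addrA//; exists v, w.
Qed.

Lemma zero_ideal_subproof : is_ideal [set 0 : R].
Proof. by split=> [|x y -> ->|r x ->]//=; rewrite ?addr0 ?mulr0. Qed.
Definition zero_ideal := Ideal zero_ideal_subproof.

Lemma zero_ideal_le I : zero_ideal <<= I.
Proof. by move=> _ ->; exact: (ideal_0 (idealP I)). Qed.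

Lemma ideal_add0 : left_id zero_ideal (@ideal_add R).
Proof.
move=> I; apply: ideal_le_anti; last exact: ideal_addr.
by apply: ideal_add_le => //; exact: zero_ideal_le.
Qed.

Lemma ideal_mul0 : left_zero zero_ideal (@ideal_mul R).
Proof.
move=> I; apply: ideal_le_anti; last exact: zero_ideal_le.
by apply: ideal_mul_le => _ y -> _ /=; rewrite mul0r.
Qed.

Lemma ideal_mulDl : left_distributive (@ideal_mul R) (@ideal_add R).
Proof.
move=> I J K; apply: ideal_le_anti.
  apply: ideal_mul_le => _ k [x [y [Ix Jy ->]]] Kk; exists (x * k), (y * k).
  by split; rewrite ?mulrDl//; exact: ideal_mul_mem.
apply: ideal_add_le; apply: ideal_mul_le => x k Ix Kk; apply: ideal_mul_mem => //.
- exact: ideal_addl.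
- exact: ideal_addr.
Qed.

HB.instance Definition _ := gen_eqMixin (ideal R).
HB.instance Definition _ := gen_choiceMixin (ideal R).
HB.instance Definition _ := GRing.isNmodule.Build (ideal R) ideal_addA ideal_addC ideal_add0.
HB.instance Definition _ := GRing.Nmodule_isComPzSemiRing.Build (ideal R)
  ideal_mulA ideal_mulC ideal_mul1 ideal_mulDl ideal_mul0.

End IdealSemiring.

Definition prin (R : comPzRingType) (x : R) : ideal R := ideal_span [set x].
Definition spans (R : comPzRingType) (s : seq R) : ideal R := ideal_span [set` s].

(** * Generators, powers of sums, and regular sequences modulo an ideal *)

Section IdealTheory.
Variable R : comPzRingType.
Implicit Types (I J K L : ideal R) (x y z : R) (s : seq R).

Lemma idealr0 I : I 0. Proof. exact: ideal_0 (idealP I). Qed.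

Lemma idealD I x y : I x -> I y -> I (x + y). Proof. by move=> Ix Iy; apply: (ideal_D (idealP I)). Qed.

Lemma memD2 I J x y : I x -> J y -> x + y \ini I + J.
Proof. by move=> Ix Jy; exists x, y. Qed.

Lemma ileDl I J : I <<= I + J. Proof. exact: ideal_addl. Qed.

Lemma ileDr I J : J <<= I + J. Proof. exact: ideal_addr. Qed.

Lemma ileD I J K : I <<= K -> J <<= K -> I + J <<= K.
Proof. exact: ideal_add_le. Qed.

Lemma ileD2 I J I' J' : I <<= I' -> J <<= J' -> I + J <<= I' + J'.
Proof. by move=> II' JJ' _ [x [y [/II' Ix /JJ' Jy ->]]]; exists x, y. Qed.

Lemma ileM2 I J I' J' : I <<= I' -> J <<= J' -> I * J <<= I' * J'.
Proof. by move=> II' JJ'; apply: ideal_mul_le => x y /II' Ix /JJ' Jy; apply: ideal_mul_mem. Qed.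

Lemma ileX2 I J n : I <<= J -> I ^+ n <<= J ^+ n.
Proof. by move=> IJ; elim: n => [//|n IH]; rewrite !exprS; apply: ileM2. Qed.

Lemma ileMl I J : I * J <<= J.
Proof. by apply: ideal_mul_le => x y _; exact: idealMl. Qed.

Lemma ileMr I J : I * J <<= I. Proof. by rewrite mulrC; exact: ileMl. Qed.

Lemma ile_trans I J K : I <<= J -> J <<= K -> I <<= K.
Proof. by move=> IJ JK x /IJ /JK. Qed.


Lemma ileXX I p q : (p <= q)%N -> I ^+ q <<= I ^+ p.
Proof. by move=> /subnKC <-; rewrite exprD; exact: ileMr. Qed.

Lemma mem_one I : I 1 <-> I = 1.
Proof.
split=> [I1|->//]; apply: ideal_le_anti => x _ //.
by rewrite -[x]mulr1; exact: idealMl.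
Qed.

Lemma ideal_expE I n : ideal_exp I n = I ^+ n.
Proof. by elim: n => [//|n IH]; rewrite exprS -IH. Qed.

Lemma memX I x n : I x -> x ^+ n \ini I ^+ n.
Proof. by move=> Ix; elim: n => [//|n IH]; rewrite !exprS; exact: ideal_mul_mem. Qed.

Lemma ile_add_sub I J : J <<= I -> I + J = I.
Proof. by move=> JI; apply: ideal_le_anti; [exact: ileD|exact: ileDl]. Qed.

Lemma prinP x z : prin x z <-> exists r, z = r * x.
Proof.
split=> [|[r ->]]; last by apply: idealMl; exact: span_mem.
pose L := [set z : R | exists r, z = r * x].
have iL : is_ideal L.
  split=> [|_ _ [r ->] [r' ->]|t _ [r ->]]; first by exists 0; rewrite mul0r.
  - by exists (r + r'); rewrite mulrDl.
  - by exists (t * r); rewrite mulrA.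
by move=> /(_ L); apply; split=> // _ ->; exists 1; rewrite mul1r.
Qed.

Lemma prin_mem x : prin x x. Proof. exact: span_mem. Qed.

Lemma prin_le x I : (prin x <<= I) <-> I x.
Proof. by split=> [|Ix]; [apply; exact: prin_mem|apply: span_le => _ ->]. Qed.

Lemma prinM x y : prin (x * y) = prin x * prin y.
Proof.
apply: ideal_le_anti; first by apply/prin_le; apply: ideal_mul_mem; exact: prin_mem.
apply: ideal_mul_le => _ _ /prinP[r ->] /prinP[t ->].
by apply/prinP; exists (r * t); rewrite mulrACA.
Qed.

Lemma prinX x n : prin (x ^+ n) = prin x ^+ n.
Proof.
elim: n => [|n IH]; last by rewrite !exprS prinM IH.
by rewrite !expr0; apply/mem_one; exact: prin_mem.
Qed.

Lemma prin0 : prin 0 = 0 :> ideal R.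
Proof. by apply: ideal_le_anti; [apply/prin_le|exact: zero_ideal_le]. Qed.

Lemma memDprin I x z : z \ini I + prin x <-> exists r, I (z - r * x).
Proof.
split=> [[i [_ [Ii /prinP[r ->] ->]]]|[r Iz]]; first by exists r; rewrite addrK.
by rewrite -[z](subrK (r * x)); apply: memD2 => //; apply/prinP; exists r.
Qed.

Lemma spans_nil : spans [::] = 0 :> ideal R.
Proof. by apply: ideal_le_anti; [apply: span_le => ?|exact: zero_ideal_le]. Qed.

Lemma spans_mem s x : x \in s -> spans s x.
Proof. by move=> xs; apply: span_mem. Qed.

Lemma spans_le s I : (forall x, x \in s -> I x) <-> spans s <<= I.
Proof.
split=> [sI|sI x /spans_mem /sI//]; by apply: span_le => x /= /sI.
Qed.

Lemma spans_cons x s : spans (x :: s) = prin x + spans s.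
Proof.
apply: ideal_le_anti.
  apply/spans_le => y; rewrite inE => /predU1P[->|ys].
    by apply: ileDl; exact: prin_mem.
  by apply: ileDr; exact: spans_mem.
apply: ileD; first by apply/prin_le; apply: spans_mem; exact: mem_head.
by apply/spans_le => y ys; apply: spans_mem; rewrite inE ys orbT.
Qed.

Lemma spans_cat s t : spans (s ++ t) = spans s + spans t.
Proof. by elim: s => [|x s IH] /=; rewrite ?spans_nil ?add0r // !spans_cons IH addrA. Qed.

Lemma memMprin I x z : z \ini I * prin x <-> exists2 r, I r & z = r * x.
Proof.
split=> [|[r Ir ->]]; last by apply: ideal_mul_mem => //; exact: prin_mem.
pose L := [set z : R | exists2 r, I r & z = r * x].
have iL : is_ideal L.
  split=> [|_ _ [r Ir ->] [r' Ir' ->]|t _ [r Ir ->]]; first by exists 0; rewrite ?mul0r//; exact: idealr0.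
  - by exists (r + r'); rewrite ?mulrDl//; exact: idealD.
  - by exists (t * r); rewrite ?mulrA//; exact: idealMl.
move=> /(_ L); apply; split=> // _ [u [_ [Iu /prinP[t ->] ->]]].
by exists (u * t); rewrite ?mulrA//; exact: idealMr.
Qed.

Lemma spansP s z : spans s z <-> exists c : nat -> R, z = \sum_(i < size s) c i * s`_i.
Proof.
split=> [|[c ->]]; last by apply: ideal_sum => i _; apply: idealMl; apply: spans_mem; exact: mem_nth.
elim: s z => [|x s IH] z /=.
  by rewrite spans_nil => ->; exists (fun=> 0); rewrite big_ord0.
rewrite spans_cons => -[_ [y [/prinP[r ->] /IH[c ->] ->]]].
by exists (fun i => if i is j.+1 then c j else r); rewrite big_ord_recl.
Qed.

Lemma addX_le1 I J n : (I + J) ^+ n <<= I + J ^+ n.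
Proof.
elim: n => [|n IH]; first exact: ileDr.
rewrite exprS mulrDl; apply: ileD; first by apply: ile_trans (@ileDl _ _); exact: ileMr.
apply: (@ile_trans _ (J * (I + J ^+ n))); first exact: ileM2 IH.
by rewrite mulrDr -exprS; apply: ileD2 => //; exact: ileMl.
Qed.

(** In the expanded power, every term outside J^(n+1) has a factor from I. *)
Lemma addXS_le I J n : (I + J) ^+ n.+1 <<= I * (I + J) ^+ n + J ^+ n.+1.
Proof.
elim: n => [|n IH]; first by rewrite !expr0 mulr1 !expr1.
rewrite exprS mulrDl; apply: ileD; first exact: ileDl.
apply: (@ile_trans _ (J * (I * (I + J) ^+ n + J ^+ n.+1))); first exact: ileM2 IH.
rewrite mulrDr -exprS; apply: ileD2 => //.
by rewrite mulrCA; apply: ileM2 => //; rewrite exprS; apply: ileM2 => //; exact: ileDr.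
Qed.

Lemma ile_colon I (A : set R) : I <<= colon I A.
Proof. by move=> x Ix a _; exact: idealMl. Qed.

Definition regular I x := forall y, I (x * y) -> I y.

Lemma regularM I x y : regular I x -> regular I y -> regular I (x * y).
Proof. by move=> rx ry z; rewrite -mulrA => /rx/ry. Qed.

Lemma regularX I x n : regular I x -> regular I (x ^+ n).
Proof.
move=> rx; elim: n => [|n IH]; first by move=> y; rewrite mul1r.
by rewrite exprS; exact: regularM.
Qed.

Fixpoint regseq I s : Prop :=
  if s is x :: s' then regular I x /\ regseq (I + prin x) s' else True.

End IdealTheory.

Lemma ideal_ltP (R : comPzRingType) (I J : ideal R) : (I : set R) `<` J <-> I <<= J /\ exists2 x, J x & ~ I x.
Proof.
rewrite properEneq; split=> [[/eqP IJ /[dup] sIJ]|[sIJ [x Jx nIx]]].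
  split=> //; apply: contrapT => nex; apply: IJ; rewrite eqEsubset; split=> // x Jx.
  by apply: contrapT => nIx; apply: nex; exists x.
by split=> //; apply/eqP => IJ; apply: nIx; rewrite IJ.
Qed.

(** * Noetherian induction *)

Section Noetherian.
Variable R : comPzRingType.
Hypothesis nR : noetherian R.
Implicit Types (I J K L : ideal R) (x y z : R) (s : seq R).

Lemma noeth_acc (c : nat -> ideal R) : (forall i, c i <<= c i.+1) ->
  exists i, forall j, c j <<= c i.
Proof.
move=> cS; have cle i j : (i <= j)%N -> c i <<= c j.
  by move=> /subnK <-; elim: (j - i)%N => [//|k IH]; rewrite addSn; apply: ile_trans IH _.
have iU : is_ideal (\bigcup_i c i).
  split=> [|x y [i _ ci] [j _ cj]|r x [i _ ci]]; first by exists 0%N => //; exact: idealr0.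
  - exists (maxn i j) => //; apply: idealD.
      exact: cle (leq_maxl _ _) _ ci.
    exact: cle (leq_maxr _ _) _ cj.
  - by exists i => //; exact: idealMl.
have [s Us] := nR (Ideal iU).
have [i sci] : exists i, forall x, x \in s -> c i x.
  have : forall x, x \in s -> exists i, c i x.
    by move=> x xs; have : Ideal iU x by [rewrite Us; exact: span_mem]; case=> i _ ?; exists i.
  elim: s {Us} => [|x s IH] h; first by exists 0%N.
  have [i ci] := IH (fun y ys => h y (@mem_behead _ (x :: s) y ys)); have [j cj] := h x (mem_head _ _).
  exists (maxn i j) => y; rewrite inE => /predU1P[->|/ci].
    exact: cle (leq_maxr _ _) _ cj.
  exact: cle (leq_maxl _ _) _.
exists i => j x cx; have : Ideal iU x by exists j.
by rewrite Us; apply: span_le.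
Qed.

Lemma noeth_ind (P : ideal R -> Prop) :
  (forall I, (forall J, I <<= J -> I <> J -> P J) -> P I) -> forall I, P I.
Proof.
move=> H I; apply: contrapT => nPI.
(* Every counterexample has a strictly larger one; iterating the choice contradicts the chain
   condition. *)
have next (J : {J : ideal R | ~ P J}) : {K : {J : ideal R | ~ P J} | sval J <<= sval K /\ sval J <> sval K}.
  apply: cid; apply: contrapT => nex; case: J nex => J nPJ nex; apply: (nPJ).
  by apply: H => K JK nJK; apply: contrapT => nPK; apply: nex; exists (exist _ K nPK).
pose c := fix c n := if n is n'.+1 then sval (next (c n')) else exist (fun J => ~ P J) I nPI.
have [i /(_ i.+1) h] := @noeth_acc (fun n => sval (c n)) (fun n => (svalP (next (c n))).1).
have [h1 h2] := svalP (next (c i)); apply: h2.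
by apply: ideal_le_anti.
Qed.

Lemma noeth_max (P : ideal R -> Prop) I : P I ->
  exists M, [/\ I <<= M, P M & forall J, M <<= J -> P J -> J = M].
Proof.
elim/noeth_ind: I => I IH PI.
have [[J [IJ nIJ PJ]]|nex] := pselect (exists J, [/\ I <<= J, I <> J & P J]).
  have [M [JM PM maxM]] := IH J IJ nIJ PJ.
  by exists M; split=> //; exact: ile_trans JM.
exists I; split=> // J IJ PJ; apply: contrapT => nIJ; apply: nex; exists J; split=> //.
by move=> e; apply: nIJ.
Qed.

End Noetherian.

(** Locality is expressed by units, the form that can be checked directly on a localization. *)
Record local_noeth (R : comPzRingType) (m : ideal R) : Prop := LocalNoeth {
  ln_noeth : noetherian R;
  ln_proper : ~ m 1;
  ln_unit : forall x, ~ m x -> exists y, y * x = 1 }.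

Lemma local_ring_noeth (R : comPzRingType) (m : ideal R) :
  noetherian R -> local_ring m -> local_noeth m.
Proof.
move=> nR [[m1 mmax] uniq]; split=> // [/mem_one//|x nmx].
apply: contrapT => nux.
have [|M [xM nM maxM]] := @noeth_max R nR (fun I => I <> unit_ideal) (prin x).
  by move=> /mem_one/prinP[y e]; apply: nux; exists y.
have/uniq eM : maximal_ideal M.
  split=> // J MJ; have [->|nJ] := pselect (J = unit_ideal); first by right.
  by left; apply: maxM.
by apply: nmx; rewrite -eM; apply: xM; exact: prin_mem.
Qed.

(** * Nakayama's lemma and Krull's intersection theorem *)

Section LocalNoetherian.
Variables (R : comPzRingType) (m : ideal R).
Hypothesis lR : local_noeth m.
Implicit Types (I J K L N : ideal R) (x y z : R) (s : seq R).

Lemma ln_1B x : m x -> exists y, y * (1 - x) = 1.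
Proof.
move=> mx; apply: (ln_unit lR) => m1x; apply: (ln_proper lR).
by rewrite -[1](subrK x); exact: idealD.
Qed.

Lemma proper_le_m I : ~ I 1 -> I <<= m.
Proof.
move=> I1 x Ix; apply: contrapT => /(ln_unit lR)[y yx]; apply: I1.
by rewrite -yx; exact: idealMl.
Qed.

(** Let M be maximal among the ideals between K and K + N that do not contain N. For a in m and z in
    N, if a z were outside M, then N would lie in M + (a z), so (1 - r a) z and hence z would be in
    M. Thus M contains K + m N, hence N. *)
Lemma nakayama N K : N <<= K + m * N -> N <<= K.
Proof.
move=> h; apply: contrapT => nNK.
have [|M [KM MP maxM]] := @noeth_max R (ln_noeth lR) (fun I => I <<= K + N /\ ~ N <<= I) K.
  by split=> //; exact: ileDl.
case: MP => MKN nNM; apply: nNM; apply: ile_trans h _.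
have [//|] := pselect (K + m * N <<= M).
move=> /(_ (ileD KM _)) h; exfalso; apply: h; apply: ideal_mul_le => a z ma Nz.
apply: contrapT => nMaz.
have NMaz : N <<= M + prin (a * z).
  apply: contrapT => h2; apply: nMaz.
  have <- : M + prin (a * z) = M.
    apply: maxM; first exact: ileDl.
    by split=> //; apply: ileD => //; apply/prin_le; apply: ileDr; exact: idealMl.
  by apply: ileDr; exact: prin_mem.
have /memDprin[r Mz] := NMaz z Nz.
have [|y e] := @ln_1B (r * a); first exact: idealMl.
have Mz' : M z.
  rewrite -[z]mul1r -e -mulrA; apply: idealMl.
  by rewrite mulrBl mul1r -mulrA.
by apply: nMaz; exact: idealMl.
Qed.

Lemma nakayama_eq N K x : m x -> N <<= K + prin x * N -> N <<= K.
Proof.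
move=> mx h; apply: nakayama; apply: ile_trans h _; apply: ileD2 => //.
by apply: ileM2 => //; apply/prin_le.
Qed.

(* Krull's intersection theorem for the powers of one element: the chain of colon *)
(* ideals (K : x^j) stabilizes, so the intersection N satisfies N = K + x N. *)
Lemma krull_prin K x z : m x -> (forall j, z \ini K + prin (x ^+ j)) -> K z.
Proof.
move=> mx hz.
have iN : is_ideal [set z | forall j, z \ini K + prin (x ^+ j)].
  split=> [j|u v hu hv j|r u hu j]; [exact: idealr0|exact: idealD|exact: idealMl].
pose N := Ideal iN.
suff : N <<= K by apply.
apply: (nakayama_eq mx).
have [|r hr] := noeth_acc (ln_noeth lR) (c := fun j => colon K [set x ^+ j]).
  by move=> j y hy _ ->; rewrite exprS -mulrA; apply: idealMl; exact: hy.
move=> u hu; have /memDprin[v Kv] := hu r.+1.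
rewrite -[u](subrK (v * x ^+ r.+1)); apply: memD2 => //.
rewrite exprS mulrCA; apply: ideal_mul_mem; first exact: prin_mem.
move=> j; have /memDprin[w Kw] := hu (r.+1 + j)%N.
apply/memDprin; exists (w * x ^+ r) => //.
(* The colon ideals are constant from x^r on, so one factor x can be cancelled here. *)
have Kd : K (x ^+ r.+1 * (v - w * x ^+ j)).
  have -> : x ^+ r.+1 * (v - w * x ^+ j) = (u - w * x ^+ (r.+1 + j)) - (u - v * x ^+ r.+1).
    by rewrite exprD; ring.
  exact: idealB.
have /(_ _ erefl) := hr r.+1 (v - w * x ^+ j) (fun a e => eq_ind_r (fun a => K (a * _)) Kd e).
by congr (K _); ring.
Qed.

End LocalNoetherian.

(** * Length *)

Section Length.
Variables (R : comPzRingType) (m : ideal R).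
Hypothesis lR : local_noeth m.
Implicit Types (I J K L N : ideal R) (x y z : R) (s : seq R).

Lemma colon1P I x y : colon I [set x] y <-> I (x * y).
Proof. by split=> [|h a ->]//; apply. Qed.

Lemma ile_colon2 I J (A : set R) : I <<= J -> colon I A <<= colon J A.
Proof. by move=> IJ y hy a /hy /IJ. Qed.

Fixpoint chain_from K (n : nat) : Prop :=
  if n is n'.+1 then exists K', [/\ K <<= K', exists2 x, K' x & ~ K x & chain_from K' n'] else True.

(* Composition series of R/K, read from the bottom: each step adds a socle element. *)
Inductive has_len : ideal R -> nat -> Prop :=
| has_len_unit : has_len 1 0
| has_len_step K z l : ~ K z -> (forall a, m a -> K (a * z)) ->
    has_len (K + prin z) l -> has_len K l.+1.

Lemma chain_from_mono K K' n : K <<= K' -> chain_from K' n -> chain_from K n.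
Proof.
case: n => [//|n] KK' [L [K'L [x Lx nK'x] h]]; exists L; split=> //; first exact: ile_trans K'L.
by exists x => // /KK'.
Qed.

Lemma has_len_chain K l : has_len K l -> chain_from K l.
Proof.
elim=> {K l} [//|K z l nKz _ _ IH]; exists (K + prin z); split=> //; first exact: ileDl.
by exists z => //; apply: ileDr; exact: prin_mem.
Qed.

(** Add z to every member of the chain. As (K + (z))/K is simple, an inclusion stays strict while
    its upper ideal misses z; only the step where z first appears is lost. *)
Lemma chain_from_socle K z n : ~ K z -> (forall a, m a -> K (a * z)) ->
  chain_from K n.+1 -> chain_from (K + prin z) n.
Proof.
elim: n K => [//|n IH] K nKz mz [K' [KK' [x K'x nKx] h]].
have [K'z|nK'z] := pselect (K' z).
  by apply: (@chain_from_mono _ K' n.+1 _ h); apply: ileD => //; apply/prin_le.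
exists (K' + prin z); split; [exact: ileD2| |by apply: IH => // a /mz /KK'].
exists x; first exact: ileDl.
move=> /memDprin[r Kr].
have K'rz : K' (r * z) by rewrite -[r * z](subKr x); apply: idealB => //; exact: KK'.
have [mr|/(ln_unit lR)[t tr]] := pselect (m r).
  by apply: nKx; rewrite -[x](subrK (r * z)); apply: idealD => //; exact: mz.
by apply: nK'z; rewrite -[z]mul1r -tr -mulrA; exact: idealMl.
Qed.

Lemma has_len_max K l n : has_len K l -> chain_from K n -> (n <= l)%N.
Proof.
move=> h; elim: h n => {K l} [|K z l nKz mz _ IH] [|n]//.
  by move=> [K' [_ [x _ /(_ I)]]].
by move=> /(chain_from_socle nKz mz)/IH.
Qed.

Lemma has_len_le K K' l l' : K <<= K' -> has_len K l -> has_len K' l' -> (l' <= l)%N.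
Proof. by move=> KK' Kl /has_len_chain h; apply: has_len_max Kl (chain_from_mono KK' h). Qed.

Lemma has_len_uniq K l l' : has_len K l -> has_len K l' -> l = l'.
Proof.
by move=> h h'; apply/eqP; rewrite eqn_leq (has_len_le _ h' h)// (has_len_le _ h h').
Qed.

Lemma has_len_gt0 K l : ~ K 1 -> has_len K l -> (0 < l)%N.
Proof. by move=> nK1 h; case: h nK1 => [/(_ I)//|//]. Qed.

(** The last power of m not contained in K supplies a socle element modulo K. *)
Lemma has_len_exists K r : m ^+ r <<= K -> exists l, has_len K l.
Proof.
elim/(noeth_ind (ln_noeth lR)): K r => K IH r mK.
have [/mem_one ->|nK1] := pselect (K 1); first by exists 0%N; exact: has_len_unit.
have [r' [nmK mK']] : exists r', ~ (m ^+ r' <<= K) /\ m ^+ r'.+1 <<= K.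
  elim: r mK => [/(_ 1 I)//|r IHr] h; have [/IHr//|nmK] := pselect (m ^+ r <<= K).
  by exists r.
have [z mz nKz] : exists2 z, z \ini m ^+ r' & ~ K z.
  by apply: contrapT => nex; apply: nmK => z mz; apply: contrapT => nKz; apply: nex; exists z.
have [|e||l hl] := IH (K + prin z) _ _ r; first exact: ileDl.
- by apply: nKz; rewrite e; apply: ileDr; exact: prin_mem.
- exact: ile_trans mK (@ileDl _ _ _).
by exists l.+1; apply: (has_len_step nKz) => // a ma; apply: mK'; rewrite exprS; exact: ideal_mul_mem.
Qed.

(** Additivity on 0 -> A/(K : f) -> A/K -> A/(K + f) -> 0: multiplication by f carries a composition
    series of the first term into A/K, where one of the last term continues it. *)
Lemma has_len_colon K f p q : has_len (colon K [set f]) p -> has_len (K + prin f) q ->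
  has_len K (p + q).
Proof.
move: {1 3}(colon K [set f]) (erefl (colon K [set f])) => C eC h.
elim: h K eC => {C p} [|C z p nz mz h IH] K eC hq.
  rewrite add0n; suff <- : K + prin f = K by [].
  by apply: ile_add_sub; apply/prin_le; rewrite -[f]mulr1; apply/colon1P; rewrite -eC.
rewrite addSn; apply: (@has_len_step K (f * z)).
- by move=> /colon1P; rewrite -eC.
- by move=> a /mz; rewrite eC => /colon1P; rewrite mulrCA.
apply: IH.
  apply: ideal_le_anti.
    rewrite eC; apply: ileD; first by apply: ile_colon2; exact: ileDl.
    by apply/prin_le/colon1P; apply: ileDr; exact: prin_mem.
  move=> u /colon1P/memDprin[a ha]; apply/memDprin; exists a => //.
  by rewrite eC; apply/colon1P; rewrite mulrBr mulrCA.
suff -> : K + prin (f * z) + prin f = K + prin f by [].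
rewrite -addrA (addrC (prin _)) (@ile_add_sub _ (prin f))//.
by apply/prin_le; apply: idealMr; exact: prin_mem.
Qed.

End Length.

(** * Flat local extensions *)

Section Extension.
Variables (A B : comPzRingType) (phi : {rmorphism A -> B}).
Implicit Types (I J K : ideal A) (L : ideal B) (s : seq A).

Definition extI I : ideal B := ideal_span [set phi x | x in (I : set A)].

Lemma ext_mem I a : I a -> extI I (phi a).
Proof. by move=> Ia; apply: span_mem; exists a. Qed.

Lemma ext_le I L : (extI I <<= L) <-> (forall a, I a -> L (phi a)).
Proof. by split=> [h a /ext_mem/h//|h]; apply: span_le => _ [a /h ? <-]. Qed.

Lemma pre_subproof L : is_ideal [set a | L (phi a)].
Proof.
by split=> [|u v hu hv|r u hu] /=; rewrite ?rmorph0 ?rmorphD ?rmorphM;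
  [exact: idealr0|exact: idealD|exact: idealMl].
Qed.
Definition preI L : ideal A := Ideal (pre_subproof L).

Lemma ext_mono I J : I <<= J -> extI I <<= extI J.
Proof. by move=> IJ; apply/ext_le => a /IJ; exact: ext_mem. Qed.

Lemma ext1 : extI 1 = 1.
Proof. by apply/mem_one; rewrite -(rmorph1 phi); exact: ext_mem. Qed.

Lemma extD I J : extI (I + J) = extI I + extI J.
Proof.
apply: ideal_le_anti.
  by apply/ext_le => _ [x [y [Ix Jy ->]]]; rewrite rmorphD; apply: memD2; exact: ext_mem.
by apply: ileD; apply: ext_mono; [exact: ileDl|exact: ileDr].
Qed.

Lemma extM I J : extI (I * J) = extI I * extI J.
Proof.
apply: ideal_le_anti.
  suff h : I * J <<= preI (extI I * extI J) by apply/ext_le => a /h.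
  by apply: ideal_mul_le => u v Iu Jv; rewrite /ideal_set /= rmorphM; apply: ideal_mul_mem; exact: ext_mem.
apply: ideal_mul_le => x y hx hy.
suff /(_ x hx) h : extI I <<= colon (extI (I * J)) (extI J) by rewrite [x * y]mulrC; exact: h.
apply/ext_le => a Ia b hb; rewrite [b * _]mulrC; suff /(_ b hb) /(_ _ erefl) : extI J <<= colon (extI (I * J)) [set phi a] by [].
by apply/ext_le => c Jc _ ->; rewrite -rmorphM; apply: ext_mem; exact: ideal_mul_mem.
Qed.

Lemma extX I n : extI (I ^+ n) = extI I ^+ n.
Proof. by elim: n => [|n IH]; rewrite ?expr0 ?ext1 // !exprS extM IH. Qed.

Lemma ext_prin a : extI (prin a) = prin (phi a).
Proof.
apply: ideal_le_anti; last by apply/prin_le; apply: ext_mem; exact: prin_mem.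
by apply/ext_le => _ /prinP[r ->]; rewrite rmorphM; apply: idealMl; exact: prin_mem.
Qed.

Lemma ext0 : extI 0 = 0.
Proof. by rewrite -prin0 ext_prin rmorph0 prin0. Qed.

Lemma ext_spans s : extI (spans s) = spans (map phi s).
Proof.
by elim: s => [|x s IH] /=; rewrite ?spans_nil ?ext0// !spans_cons extD ext_prin IH.
Qed.

(* Flatness enters only through colon ideals: (IB : a) = (I : a)B. *)
Record good_ext (m : ideal A) : Prop := GoodExt {
  ge_ln : local_noeth (extI m);
  ge_flat : forall I a b, extI I (phi a * b) -> extI (colon I [set a]) b }.

Variable m : ideal A.
Hypotheses (lA : local_noeth m) (ge : good_ext m).

(** If a is not in I, then (I : a) lies in m, and flatness would put 1 into mB. *)
Lemma ge_faithful I a : extI I (phi a) -> I a.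
Proof.
rewrite -[phi a]mulr1 => /(ge_flat ge) h; apply: contrapT => nIa.
apply: (ln_proper (ge_ln ge)); suff /ext_mono : colon I [set a] <<= m by apply.
by apply: (proper_le_m lA) => /colon1P; rewrite mulr1.
Qed.

Lemma ge_faithful_le I J : extI I <<= extI J -> I <<= J.
Proof. by move=> h a Ia; apply: ge_faithful; apply: h; exact: ext_mem. Qed.

(** As mB is the maximal ideal of B, simple steps stay simple. *)
Lemma ge_len K l : has_len m K l -> has_len (extI m) (extI K) l.
Proof.
elim=> {K l} [|K z l nKz mz _]; first by rewrite ext1; exact: has_len_unit.
rewrite extD ext_prin; apply: has_len_step; first by move/ge_faithful.
move=> b; suff /(_ b) : extI m <<= colon (extI K) [set phi z].
  by move=> h /h/colon1P; rewrite mulrC.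
by apply/ext_le => a /mz; rewrite colon1P mulrC -rmorphM; exact: ext_mem.
Qed.

Lemma ge_regular I a : regular I a -> regular (extI I) (phi a).
Proof.
move=> ra b /(ge_flat ge); apply: ext_mono => x /colon1P; exact: ra.
Qed.

Lemma ge_regseq I s : regseq I s -> regseq (extI I) (map phi s).
Proof.
elim: s I => [//|a s IH] I [ra /IH]; rewrite extD ext_prin => h; split=> //.
exact: ge_regular.
Qed.

End Extension.

Lemma extI_id (A : comPzRingType) (I : ideal A) : extI idfun I = I.
Proof.
by apply: ideal_le_anti; [apply/ext_le|move=> a /(@ext_mem _ _ idfun)].
Qed.

Lemma ge_id (A : comPzRingType) (m : ideal A) : local_noeth m -> good_ext idfun m.
Proof.
by move=> lA; split=> [|I a b]; rewrite !extI_id// colon1P.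
Qed.

Lemma extI_comp (A B C : comPzRingType) (phi : {rmorphism A -> B}) (psi : {rmorphism B -> C})
  (I : ideal A) : extI (psi \o phi) I = extI psi (extI phi I).
Proof.
apply: ideal_le_anti; apply/ext_le => a.
  by move=> Ia /=; apply: ext_mem; exact: ext_mem.
by move: a; suff : extI phi I <<= preI psi (extI (psi \o phi) I) by []; apply/ext_le => a /(@ext_mem _ _ (psi \o phi)).
Qed.

Lemma ge_comp (A B C : comPzRingType) (m : ideal A) (phi : {rmorphism A -> B}) (psi : {rmorphism B -> C}) :
  good_ext phi m -> good_ext psi (extI phi m) -> good_ext (psi \o phi) m.
Proof.
move=> gphi gpsi; split=> [|I a b]; rewrite extI_comp; first exact: ge_ln gpsi.
move=> /(ge_flat gpsi); rewrite extI_comp; apply: ext_mono => x /colon1P /(ge_flat gphi).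
by [].
Qed.

(** * Polynomial ideals and localization *)

Section PolyIdeals.
Variable A : comNzRingType.
Implicit Types (I : ideal A) (F P Q : {poly A}).

Lemma poly_ideal_subproof I : is_ideal [set P : {poly A} | forall i, I P`_i].
Proof.
split=> [i|P Q hP hQ i|P Q hQ i] /=; rewrite ?coef0 ?coefD; [exact: idealr0|exact: idealD|].
by rewrite coefM; apply: ideal_sum => j _; exact: idealMl.
Qed.
Definition poly_ideal I : ideal {poly A} := Ideal (poly_ideal_subproof I).

(* McCoy's argument: the leading coefficient of P is killed modulo I by the *)
(* coefficients of F, from the top one down, which lets one lower the degree of P. *)
Lemma mccoy I F P : (forall z, (forall i, I (F`_i * z)) -> I z) ->
  poly_ideal I (F * P) -> poly_ideal I P.
Proof.
move=> hF; move: {2}(size P) (leqnn (size P)) => n; elim: n P => [|n IH] P.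
  by rewrite size_poly_leq0 => /eqP -> _ i; rewrite coef0; exact: idealr0.
move=> sP hFP.
suff h j : poly_ideal I (take_poly j F * P) -> forall i, (i < j)%N -> poly_ideal I (F`_i *: P).
  move=> k; apply: hF => i; have [ltiF|leFi] := ltnP i (size F); last first.
    by rewrite nth_default// mul0r; exact: idealr0.
  by rewrite -coefZ; apply: (h (size F)) => //; rewrite take_poly_id.
elim: j => [//|j IHj] hj.
have E : take_poly j.+1 F = take_poly j F + F`_j *: 'X^j.
  apply/polyP => k; rewrite coefD coefZ coefXn !coef_take_poly ltnS leq_eqVlt.
  by case: eqP => [->|_]; rewrite ?ltnn ?add0r ?mulr1 ?mulr0 ?addr0.
have FjP : poly_ideal I (F`_j *: P).
  have top : I (F`_j * P`_n).
    have := hj (j + n)%N; rewrite E mulrDl coefD.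
    rewrite nth_default ?add0r; last first.
      apply: leq_trans (size_polyMleq _ _) _.
      have := size_take_poly j F; move: sP; lia.
    by rewrite -scalerAl coefZ coefXnM ltnNge leq_addr /= addKn.
  rewrite -[_ *: P](subrK ((F`_j * P`_n) *: 'X^n)); apply: idealD; last first.
    by move=> k; rewrite coefZ; exact: idealMr.
  apply: IH.
    apply/leq_sizeP => k lenk; rewrite coefB !coefZ coefXn.
    move: lenk; rewrite leq_eqVlt => /predU1P[<-|ltnk]; first by rewrite eqxx mulr1 subrr.
    rewrite (gtn_eqF ltnk) mulr0 subr0 [P`_k]nth_default ?mulr0//.
    exact: leq_trans sP _.
  rewrite mulrBr; apply: idealB; first by rewrite -scalerAr => k; rewrite coefZ; exact: idealMl.
  by apply: idealMl => k; rewrite coefZ; exact: idealMr.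
move=> i; rewrite ltnS leq_eqVlt => /predU1P[->//|]; apply: IHj.
have -> : take_poly j F * P = take_poly j.+1 F * P - 'X^j * (F`_j *: P).
  by rewrite E -!mul_polyC; ring.
by apply: idealB => //; exact: idealMl.
Qed.

(** The ideals L n of coefficients in degree n of elements of K of degree at most n become constant
    at some N, and finitely many polynomials realize L 0, ..., L N. *)
Lemma hilbert_basis : noetherian A -> noetherian {poly A}.
Proof.
move=> nA K.
have iL n : is_ideal [set a : A | exists P, [/\ K P, (size P <= n.+1)%N & P`_n = a]].
  split=> [|_ _ [P [KP sP <-]] [Q [KQ sQ <-]]|r _ [P [KP sP <-]]].
  - by exists 0; rewrite size_poly0 coef0; split=> //; exact: idealr0.
  - exists (P + Q); rewrite coefD; split=> //; first exact: idealD.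
    by apply: leq_trans (size_polyD _ _) _; rewrite geq_max sP.
  - exists (r%:P * P); rewrite coefCM; split=> //; first exact: idealMl.
    by rewrite mul_polyC; apply: leq_trans (size_scale_leq _ _) _.
pose L n := Ideal (iL n).
have LS n : L n <<= L n.+1.
  move=> _ [P [KP sP <-]]; exists ('X * P); rewrite coefXM; split=> //; first exact: idealMl.
  by rewrite mulrC; apply: leq_trans (size_polyMleq _ _) _; rewrite size_polyX addn2.
have [N LN] := noeth_acc nA LS.
have [S [KS hS]] : exists S : seq {poly A}, (forall P, P \in S -> K P) /\
    forall i a, (i <= N)%N -> L i a -> exists Q, [/\ spans S Q, (size Q <= i.+1)%N & Q`_i = a].
  have one i : exists S : seq {poly A}, (forall P, P \in S -> K P) /\
      forall a, L i a -> exists Q, [/\ spans S Q, (size Q <= i.+1)%N & Q`_i = a].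
    have [t et] := nA (L i).
    have {et} [et1 et2] : spans t <<= L i /\ L i <<= spans t by rewrite /spans -et; split.
    suff [S [KS hS]] : exists S : seq {poly A}, (forall P, P \in S -> K P) /\
        forall a, spans t a -> exists Q, [/\ spans S Q, (size Q <= i.+1)%N & Q`_i = a].
      by exists S; split=> // a /et2/hS.
    elim: t et1 {et2} => [_|x t IH].
      exists [::]; split=> // a; rewrite spans_nil => ->.
      by exists 0; rewrite size_poly0 coef0; split=> //; exact: idealr0.
    rewrite spans_cons => h; have [|S [KS hS]] := IH; first by apply: ile_trans h; exact: ileDr.
    have [P [KP sP Px]] : L i x by apply: h; apply: ileDl; exact: prin_mem.
    exists (P :: S); split=> [Q|a]; first by rewrite inE => /predU1P[->//|/KS].
    move=> [_ [b [/prinP[r ->] /hS[Q [SQ sQ <-]] ->]]].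
    exists (r%:P * P + Q); rewrite coefD coefCM Px; split=> //.
      rewrite spans_cons; apply: memD2 => //; apply: idealMl; exact: prin_mem.
    apply: leq_trans (size_polyD _ _) _; rewrite geq_max sQ andbT mul_polyC.
    exact: leq_trans (size_scale_leq _ _) _.
  elim: N {LN} => [|N [S [KS hS]]].
    have [S [KS hS]] := one 0%N; exists S; split=> // i a; rewrite leqn0 => /eqP ->; exact: hS.
  have [S' [KS' hS']] := one N.+1; exists (S ++ S'); split.
    by move=> P; rewrite mem_cat => /orP[/KS|/KS'].
  move=> i a; rewrite leq_eqVlt ltnS => /predU1P[->/hS'|leiN /(hS _ _ leiN)] [Q [SQ sQ Qa]];
  exists Q; split=> //; rewrite spans_cat; [exact: ileDr|exact: ileDl].
exists S; apply: ideal_le_anti; last by apply/spans_le.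
suff h n P : (size P <= n)%N -> K P -> spans S P by move=> P; exact: (h (size P)).
elim: n P => [|n IH] P sP KP.
  by move: sP; rewrite size_poly_leq0 => /eqP ->; exact: idealr0.
(* Above degree N the top coefficient is realized in degree N and shifted by a power of X. *)
have LP : L (minn n N) P`_n.
  have Lp : L n P`_n by exists P.
  by have [leNn|ltNn] := leqP n N => //; exact: LN Lp.
have [Q [SQ sQ Qn]] := hS _ _ (geq_minr n N) LP.
rewrite -[P](subrK ('X^(n - minn n N) * Q)); apply: idealD; last exact: idealMl.
have KQ : K Q by move: SQ; apply: span_le.
apply: IH; last by apply: idealB => //; exact: idealMl.
have coefQ k : (n <= k)%N -> ('X^(n - minn n N) * Q)`_k = if k == n then P`_n else 0.
  move=> lenk; rewrite coefXnM ltnNge (leq_trans (leq_subr _ _) lenk) /=.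
  case: eqP => [->|/eqP nkn]; first by rewrite subKn ?geq_minl.
  apply: nth_default; apply: leq_trans sQ _.
  have := geq_minl n N; move: nkn lenk; lia.
apply/leq_sizeP => k lenk; rewrite coefB coefQ//; case: eqP => [->|/eqP nkn]; first exact: subrr.
by rewrite subr0; apply: nth_default; apply: leq_trans sP _; rewrite ltn_neqAle eq_sym nkn.
Qed.

End PolyIdeals.

(** * Localization at a multiplicative set of nonzerodivisors *)

Section Localization.
Variables (D : comNzRingType) (S : set D).
Hypotheses (S1 : S 1) (SM : forall x y, S x -> S y -> S (x * y)).
Hypothesis Sreg : forall s, S s -> forall x, s * x = 0 -> x = 0.

(** As denominators are nonzerodivisors, equality of fractions is plain cross multiplication. *)
Definition preloc := {x : D * D | `[< S x.2 >]}.
Definition preloc_eq (x y : preloc) := (val x).1 * (val y).2 == (val y).1 * (val x).2.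

Lemma preloc_den (x : preloc) : S (val x).2.
Proof. exact: (asboolW (valP x)). Qed.

Lemma Scancel s x y : S s -> s * x = s * y -> x = y.
Proof. by move=> Ss /eqP; rewrite -subr_eq0 -mulrBr => /eqP /(Sreg Ss)/eqP; rewrite subr_eq0 => /eqP. Qed.

Lemma preloc_eq_equiv : equiv_class_of preloc_eq.
Proof.
split=> [x|x y|y x z]; rewrite /preloc_eq ?eqxx// 1?eq_sym//.
move=> /eqP xy /eqP yz; apply/eqP; apply: (Scancel (preloc_den y)).
transitivity ((val x).1 * (val y).2 * (val z).2); first by ring.
by rewrite -xy mulrAC yz; ring.
Qed.

Canonical preloc_equiv := EquivRelPack preloc_eq_equiv.
Definition loc := {eq_quot preloc_equiv}.
HB.instance Definition _ := EqQuotient.on loc.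
HB.instance Definition _ := Choice.on loc.

(** A pair whose denominator is outside S becomes 0/1. *)
Definition frac (p s : D) : loc :=
  \pi_loc (insubd (exist _ (0, 1) (asboolT S1) : preloc) (p, s)).

Lemma fracP p s p' s' : S s -> S s' -> frac p s = frac p' s' <-> p * s' = p' * s.
Proof.
move=> Ss Ss'; rewrite /frac; set x := insubd _ _; set y := insubd _ _.
have vx : val x = (p, s) by rewrite val_insubd; case: asboolP.
have vy : val y = (p', s') by rewrite val_insubd; case: asboolP.
have -> : (\pi_loc x = \pi_loc y) <-> (x == y %[mod loc]) by split=> /eqP.
by rewrite eqmodE /= /preloc_eq vx vy /=; split=> /eqP.
Qed.

Lemma frac_surj u : exists p s, S s /\ u = frac p s.
Proof.
exists (val (repr u)).1, (val (repr u)).2; split; first exact: preloc_den.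
rewrite /frac -surjective_pairing -[LHS]reprK; congr (\pi_loc _).
by apply: val_inj; rewrite val_insubd; case: asboolP => // /(_ (preloc_den _)).
Qed.

Definition num u := sval (cid (frac_surj u)).
Definition den u := sval (cid (svalP (cid (frac_surj u)))).
Lemma den_S u : S (den u). Proof. by case: (svalP (cid (svalP (cid (frac_surj u))))). Qed.
Lemma numden u : u = frac (num u) (den u).
Proof. by case: (svalP (cid (svalP (cid (frac_surj u))))). Qed.

Definition loc_add u v := frac (num u * den v + num v * den u) (den u * den v).
Definition loc_mul u v := frac (num u * num v) (den u * den v).
Definition loc_opp u := frac (- num u) (den u).

Lemma numdenP p s : S s -> num (frac p s) * s = p * den (frac p s).
Proof. by move=> Ss; apply/fracP => //; [exact: den_S|rewrite -numden]. Qed.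

Lemma loc_addE p s q t : S s -> S t -> loc_add (frac p s) (frac q t) = frac (p * t + q * s) (s * t).
Proof.
move=> Ss St; apply/fracP; [by apply: SM; exact: den_S|exact: SM|].
suff key a b c d : a * s = p * b -> c * t = q * d ->
    (a * d + c * b) * (s * t) = (p * t + q * s) * (b * d).
  by apply: key; exact: numdenP.
move=> h1 h2; transitivity ((a * s) * (d * t) + (c * t) * (b * s)); first by ring.
by rewrite h1 h2; ring.
Qed.

Lemma loc_mulE p s q t : S s -> S t -> loc_mul (frac p s) (frac q t) = frac (p * q) (s * t).
Proof.
move=> Ss St; apply/fracP; [by apply: SM; exact: den_S|exact: SM|].
have h1 := numdenP p Ss; have h2 := numdenP q St.
by rewrite mulrACA h1 h2; ring.
Qed.

Lemma loc_oppE p s : S s -> loc_opp (frac p s) = frac (- p) s.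
Proof. by move=> Ss; apply/fracP; rewrite ?mulNr ?numdenP//; exact: den_S. Qed.

Ltac Ssolve := repeat (first [assumption | exact: S1 | apply: SM | exact: den_S]).

Lemma loc_addA : associative loc_add.
Proof.
move=> u v w; have [p [s [Ss ->]]] := frac_surj u; have [q [t [St ->]]] := frac_surj v.
have [r [x [Sx ->]]] := frac_surj w; rewrite !loc_addE; try by Ssolve.
by congr frac; ring.
Qed.

Lemma loc_addC : commutative loc_add.
Proof. by move=> u v; rewrite /loc_add addrC [den u * _]mulrC. Qed.

Lemma loc_add0 : left_id (frac 0 1) loc_add.
Proof.
move=> u; have [p [s [Ss ->]]] := frac_surj u; rewrite loc_addE//.
by congr frac; ring.
Qed.

Lemma loc_addN : left_inverse (frac 0 1) loc_opp loc_add.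
Proof.
move=> u; have [p [s [Ss ->]]] := frac_surj u; rewrite loc_oppE// loc_addE//.
by apply/fracP; [exact: SM| exact: S1|ring].
Qed.

Lemma loc_mulA : associative loc_mul.
Proof.
move=> u v w; have [p [s [Ss ->]]] := frac_surj u; have [q [t [St ->]]] := frac_surj v.
have [r [x [Sx ->]]] := frac_surj w; rewrite !loc_mulE; try by Ssolve.
by congr frac; ring.
Qed.

Lemma loc_mulC : commutative loc_mul.
Proof. by move=> u v; rewrite /loc_mul mulrC [den u * _]mulrC. Qed.

Lemma loc_mul1 : left_id (frac 1 1) loc_mul.
Proof.
by move=> u; have [p [s [Ss ->]]] := frac_surj u; rewrite loc_mulE// !mul1r.
Qed.

Lemma loc_mulDl : left_distributive loc_mul loc_add.
Proof.
move=> u v w; have [p [s [Ss ->]]] := frac_surj u; have [q [t [St ->]]] := frac_surj v.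
have [r [x [Sx ->]]] := frac_surj w; rewrite !(loc_mulE, loc_addE); try by Ssolve.
by apply/fracP; try (by Ssolve); ring.
Qed.

HB.instance Definition _ := GRing.isZmodule.Build loc loc_addA loc_addC loc_add0 loc_addN.
HB.instance Definition _ := GRing.Zmodule_isComPzRing.Build loc loc_mulA loc_mulC loc_mul1 loc_mulDl.

Definition to_loc (p : D) : loc := frac p 1.

Lemma to_loc_additive : additive to_loc.
Proof.
move=> p q; rewrite /to_loc [- frac q 1]loc_oppE// [RHS]loc_addE//.
by rewrite !mulr1.
Qed.

Lemma to_loc_multiplicative : monoid_morphism to_loc.
Proof. by split=> // p q; rewrite /to_loc [RHS]loc_mulE// mulr1. Qed.

HB.instance Definition _ := GRing.isAdditive.Build D loc to_loc to_loc_additive.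
HB.instance Definition _ := GRing.isMonoidMorphism.Build D loc to_loc to_loc_multiplicative.

Lemma localization_exists : exists (L : comPzRingType) (f : {rmorphism D -> L}),
  [/\ forall s, S s -> exists u, u * f s = 1,
      forall u, exists p s, S s /\ f s * u = f p & injective f].
Proof.
exists loc, to_loc; split=> [s Ss|u|p q].
- exists (frac 1 s); rewrite [LHS]loc_mulE//; apply/fracP; rewrite ?mulr1 ?mul1r//.
- have [p [s [Ss ->]]] := frac_surj u; exists p, s; split=> //.
  by rewrite [LHS]loc_mulE//; apply/fracP; rewrite ?mul1r// ?mulr1 1?mulrC.
- by move=> /fracP; rewrite !mulr1; apply.
Qed.

End Localization.

(** T acts as an indeterminate: monic polynomials in T are units, and a list of elements without
    common annihilator modulo I yields one element regular modulo IB. *)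
Definition generic_ext_for (A : comPzRingType) (m : ideal A) : Prop :=
  exists (B : comPzRingType) (phi : {rmorphism A -> B}) (T : B),
  [/\ good_ext phi m,
      forall k (a : nat -> A), exists u, u * (T ^+ k - \sum_(i < k) phi (a i) * T ^+ i) = 1 &
      forall (I : ideal A) (f : seq A), (forall z, (forall x, x \in f -> I (x * z)) -> I z) ->
        regular (extI phi I) (\sum_(i < size f) phi f`_i * T ^+ i)].

(* The ring A(T), that is, A[T] localized at the polynomials outside m[T]. *)
Lemma generic_ext_nz (A : comNzRingType) (m : ideal A) : local_noeth m -> generic_ext_for m.
Proof.
move=> lA; pose S : set {poly A} := [set Q | ~ poly_ideal m Q].
(* Some coefficient of Q is a unit, so McCoy's criterion holds modulo every ideal I. *)
have S_mccoy Q I P : S Q -> poly_ideal I (Q * P) -> poly_ideal I P.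
  move=> SQ; apply: mccoy => z hz.
  have [i nmi] : exists i, ~ m Q`_i.
    by apply: contrapT => h; apply: SQ => i; apply: contrapT => nmi; apply: h; exists i.
  have [y yQ] := ln_unit lA nmi.
  by rewrite -[z]mul1r -yQ -mulrA; apply: idealMl; exact: hz.
have S1 : S 1 by move=> /(_ 0%N); rewrite coef1; exact: ln_proper lA.
have SM P Q : S P -> S Q -> S (P * Q) by move=> SP SQ /(S_mccoy _ _ _ SP).
have Sreg Q : S Q -> forall P, Q * P = 0 -> P = 0.
  move=> SQ P QP; apply/polyP => i; rewrite coef0.
  by apply: (S_mccoy Q 0 P SQ) => j; rewrite QP coef0.
have [B [f [fU fS finj]]] := localization_exists S1 SM Sreg.
pose phi : {rmorphism A -> B} := f \o polyC.
have phiE a : phi a = f a%:P by [].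
have fcancel s x L : S s -> f s * x \ini L -> x \ini L.
  by move=> /fU[u us] h; rewrite -[x]mul1r -us -mulrA; exact: idealMl.
(* Denominators can be cleared because members of S are regular modulo I[T]; flatness can then be
   checked on coefficients. *)
have extP I p : extI phi I (f p) <-> poly_ideal I p.
  split=> [|hp].
    have iL : is_ideal [set u | exists q s, [/\ S s, f s * u = f q & poly_ideal I q]].
      split=> [|u v [q [s [Ss us Iq]]] [r [t [St vt Ir]]]|w u [q [s [Ss us Iq]]]].
      - by exists 0, 1; rewrite mulr0 rmorph0; split=> //; exact: idealr0.
      - exists (t * q + s * r), (s * t); split; first exact: SM.
          by rewrite rmorphM rmorphD !rmorphM -us -vt; ring.
        by apply: idealD; exact: idealMl.
      - have [r [t [St tw]]] := fS w; exists (r * q), (s * t); split; first exact: SM.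
          by rewrite !rmorphM -us -tw; ring.
        exact: idealMl.
    suff /(_ (f p)) h : extI phi I <<= Ideal iL.
      move=> /h[q [s [Ss]]]; rewrite -rmorphM => /finj sp Iq.
      by apply: (S_mccoy s) => //; rewrite sp.
    apply/ext_le => a Ia; exists a%:P, 1; rewrite rmorph1 mul1r; split=> // i.
    by rewrite coefC; case: ifP => _ //; exact: idealr0.
  rewrite -[p]coefK poly_def rmorph_sum; apply: ideal_sum => i _.
  by rewrite -mul_polyC rmorphM; apply: idealMr; apply: (@ext_mem _ _ phi I); exact: hp.
have ge : good_ext phi m.
  split; last first.
    move=> I a b; have [p [s [Ss sb]]] := fS b => hab.
    apply: (fcancel s) => //; rewrite sb; apply/extP => i; apply/colon1P.
    rewrite -coefCM; move: i; apply/extP; rewrite rmorphM -sb mulrCA.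
    exact: idealMl.
  split.
  - move=> K; have [t et] := hilbert_basis (ln_noeth lA) (preI f K).
    exists (map f t); apply: ideal_le_anti.
      move=> u Ku; have [p [s [Ss su]]] := fS u; apply: (fcancel s) => //; rewrite su.
      have : preI f K p by rewrite /preI /ideal_set /= -su; exact: idealMl.
      by rewrite et => /(@ext_mem _ _ f); rewrite -/(spans t) ext_spans.
    apply/spans_le => _ /mapP[p pt ->].
    by have : preI f K p by [rewrite et; apply: span_mem].
  - by rewrite -(rmorph1 f) => /extP/(_ 0%N); rewrite coef1; exact: ln_proper lA.
  - move=> u nu; have [p [s [Ss su]]] := fS u.
    have [|v vp] := fU p; first by move=> hp; apply: nu; apply: (fcancel s) => //; rewrite su; apply/extP.
    by exists (v * f s); rewrite -mulrA su.
exists B, phi, (f 'X); split=> // [k a|I g hg u].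
  pose P := 'X^k - \sum_(i < k) a i *: 'X^i.
  have -> : f 'X ^+ k - \sum_(i < k) phi (a i) * f 'X ^+ i = f P.
    rewrite rmorphB rmorphXn rmorph_sum; congr (_ - _); apply: eq_bigr => i _.
    by rewrite -mul_polyC rmorphM rmorphXn.
  apply: fU => /(_ k); rewrite coefB coefXn eqxx coef_sum big1 ?subr0; last first.
    by move=> i _; rewrite coefZ coefXn gtn_eqF ?mulr0.
  exact: ln_proper lA.
pose F := \poly_(i < size g) g`_i.
have -> : \sum_(i < size g) phi g`_i * f 'X ^+ i = f F.
  rewrite /F poly_def rmorph_sum; apply: eq_bigr => i _.
  by rewrite -mul_polyC rmorphM rmorphXn.
have [p [s [Ss su]]] := fS u; move=> hu; apply: (fcancel s) => //; rewrite su; apply/extP.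
apply: (@mccoy _ _ F).
  move=> z hz; apply: hg => _ /(nthP 0)[i ilt <-].
  by have := hz i; rewrite coef_poly ilt.
by apply/extP; rewrite rmorphM -su mulrCA; exact: idealMl.
Qed.

Lemma comNz_of_comPz (A : comPzRingType) : (1 : A) != 0 -> exists A' : comNzRingType, (A' : comPzRingType) = A.
Proof.
case: A => sort cl h.
pose P := GRing.ComPzRing.Pack cl.
suff : (HB.pack_for comNzRingType P (GRing.PzSemiRing_isNonZero.Build P h) : comPzRingType) = P.
  by move=> e; eexists; exact: e.
by case: cl @P h.
Qed.

Lemma generic_ext (A : comPzRingType) (m : ideal A) : local_noeth m -> generic_ext_for m.
Proof.
have [e|/comNz_of_comPz[A' e]] := eqVneq (1 : A) 0.
  by move=> lA; case: (ln_proper lA); rewrite e; exact: idealr0.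
by move: m; rewrite -e => m; exact: generic_ext_nz.
Qed.

(** * Depth *)

Section Depth.

(* Depth at least n, witnessed in some good extension rather than in A itself: *)
(* this leaves room for generic elements, and replaces prime avoidance. *)
Definition depth_ge (n : nat) (A : comPzRingType) (m J : ideal A) : Prop :=
  exists (B : comPzRingType) (phi : {rmorphism A -> B}) (s : seq B),
  [/\ good_ext phi m, size s = n, forall x, x \in s -> extI phi m x & regseq (extI phi J) s].

Lemma depth_regseq (A : comPzRingType) (m J : ideal A) s : local_noeth m ->
  (forall x, x \in s -> m x) -> regseq J s -> depth_ge (size s) m J.
Proof. by move=> lA sm rs; exists A, idfun, s; rewrite !extI_id; split=> //; exact: ge_id. Qed.

Lemma depth_ext (A B : comPzRingType) (phi : {rmorphism A -> B}) (m J : ideal A) n :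
  good_ext phi m -> depth_ge n (extI phi m) (extI phi J) -> depth_ge n m J.
Proof.
move=> gphi [C [psi [s [gpsi ss sm rs]]]]; exists C, (psi \o phi), s.
by rewrite !extI_comp; split=> //; exact: ge_comp.
Qed.

Lemma depth_cons (A : comPzRingType) (m J : ideal A) w n : local_noeth m ->
  m w -> regular J w -> depth_ge n m (J + prin w) -> depth_ge n.+1 m J.
Proof.
move=> lA mw rw [B [phi [s [ge ss sm rs]]]]; exists B, phi, (phi w :: s); split=> //=.
- by rewrite ss.
- by move=> x; rewrite inE => /predU1P[->|/sm//]; exact: ext_mem.
- by rewrite -ext_prin -extD; split=> //; exact: (ge_regular ge).
Qed.

Lemma depth0 (A : comPzRingType) (m J : ideal A) : local_noeth m -> depth_ge 0 m J.
Proof. by move=> lA; exact: (@depth_regseq A m J [::]). Qed.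

(** The first member of the regular sequence lies in mB, so it kills the image of z modulo JB. *)
Lemma depth_socle (A : comPzRingType) (m J : ideal A) n z : local_noeth m ->
  depth_ge n.+1 m J -> (forall a, m a -> J (a * z)) -> J z.
Proof.
move=> lA [B [phi [s [ge ss sm rs]]]] hz; case: s ss sm rs => [//|b s] _ sm [rb _].
apply: (ge_faithful lA ge); apply: rb; move: (sm b (mem_head _ _)).
suff h : extI phi m <<= colon (extI phi J) [set phi z] by move=> /h/colon1P; rewrite mulrC.
by apply/ext_le => a /hz h; apply/colon1P; rewrite mulrC -rmorphM; exact: ext_mem.
Qed.

Lemma depth_socleX (A : comPzRingType) (m J : ideal A) n r z : local_noeth m ->
  depth_ge n.+1 m J -> (forall a, a \ini m ^+ r -> J (a * z)) -> J z.
Proof.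
move=> lA dJ; elim: r => [|r IH] h; first by rewrite -[z]mul1r; exact: h.
apply: (IH) => x hx; apply: (depth_socle lA dJ) => a ma.
by rewrite mulrA; apply: h; rewrite exprS; exact: ideal_mul_mem.
Qed.

Lemma annihilator_spans (A : comPzRingType) (I J : ideal A) (f : seq A) z : I <<= spans f ->
  (forall x, x \in f -> J (x * z)) -> forall a, I a -> J (a * z).
Proof.
move=> If hf a /If; suff h : spans f <<= colon J [set z] by move=> /h/colon1P; rewrite mulrC.
by apply/spans_le => x /hf; rewrite colon1P mulrC.
Qed.

Lemma regular_perm (A : comPzRingType) (J : ideal A) a c :
  regular J a -> regular (J + prin a) c -> regular (J + prin c) a.
Proof.
move=> ra rc y /memDprin[r Jr].
have /rc/memDprin[t Jt] : c * r \ini J + prin a.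
  by apply/memDprin; exists y => //; have := idealN Jr; congr (J _); ring.
apply/memDprin; exists t => //; apply: ra.
have := idealD Jr (idealMl c Jt); congr (J _); ring.
Qed.

(* The socles of A/(J + a) and A/(J + w) are isomorphic. *)
Lemma socle_exchange (A : comPzRingType) (m J : ideal A) a w :
  m a -> regular J a -> regular J w ->
  (forall z, (forall b, m b -> b * z \ini J + prin a) -> z \ini J + prin a) ->
  (forall z, (forall b, m b -> b * z \ini J + prin w) -> z \ini J + prin w).
Proof.
move=> ma ra rw soca z hz; have /memDprin[r Jr] := hz a ma.
have /soca/memDprin[c Jc] : forall b, m b -> b * r \ini J + prin a.
  move=> b mb; have /memDprin[t Jt] := hz b mb.
  apply/memDprin; exists t => //; apply: rw.
  have := idealB (idealMl a Jt) (idealMl b Jr); congr (J _); ring.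
apply/memDprin; exists c => //; apply: ra.
have := idealD Jr (idealMl w Jc); congr (J _); ring.
Qed.

(** In the induction step let a start a regular sequence modulo J. Neither A/(J + a) nor, by
    [socle_exchange], A/(J + w) has a socle, so a generic element c of m is regular modulo J, J + a
    and J + w. Lower bounds for the depth pass from J + a (n + 1) to J + a + c (n), J + c (n + 1), J
    + c + w (n) and J + w (n + 1), using the induction hypothesis twice. *)
Lemma depth_exchange n (A : comPzRingType) (m J : ideal A) w : local_noeth m ->
  depth_ge n.+1 m J -> m w -> regular J w -> depth_ge n m (J + prin w).
Proof.
elim: n A m J w => [|n IH] A0 m0 J0 w0 lA0 d0 mw0 rw0; first exact: depth0.
case: d0 => A [phi0 [s0 [ge0]]]; case: s0 => [//|a s] [ss] sm [ra rs].
apply: (depth_ext ge0); rewrite extD ext_prin.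
have rw := ge_regular ge0 rw0; have mw := @ext_mem _ _ phi0 _ _ mw0; have lA := ge_ln ge0.
move: (extI phi0 J0) (extI phi0 m0) (phi0 w0) ra rs sm rw mw lA => J m w ra rs sm rw mw lA.
have ma : m a by apply: sm; exact: mem_head.
have {}sm x : x \in s -> m x by move=> xs; apply: sm; rewrite inE xs orbT.
have soca z : (forall b, m b -> b * z \ini J + prin a) -> z \ini J + prin a.
  by move: (depth_regseq lA sm rs); rewrite ss => /(depth_socle lA); exact.
have socw := socle_exchange ma ra rw soca.
have [B [phi [T [ge _ gen]]]] := generic_ext lA.
have [f mf] := ln_noeth lA m.
have mf' : m <<= spans f by rewrite {1}mf.
pose c := \sum_(i < size f) phi f`_i * T ^+ i.
have mc : extI phi m c.
  apply: ideal_sum => i _; apply: idealMr; apply: ext_mem; rewrite mf.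
  by apply: spans_mem; exact: mem_nth.
have rc (I : ideal A) : (forall z, (forall b, m b -> I (b * z)) -> I z) -> regular (extI phi I) c.
  by move=> h; apply: gen => z hz; apply: h; exact: annihilator_spans hz.
have rcJ : regular (extI phi J) c by apply: rc => z /(_ _ ma)/ra.
have rca := rc _ soca; have rcw := rc _ socw.
rewrite extD ext_prin in rca; rewrite extD ext_prin in rcw.
apply: (depth_ext ge); rewrite extD ext_prin.
have lB := ge_ln ge.
have ra' := ge_regular ge ra; have rw' := ge_regular ge rw.
apply: (depth_cons lB mc rcw).
rewrite addrAC; apply: (IH) => //; [|exact: ext_mem|exact: regular_perm].
apply: (depth_cons lB (ext_mem ma)); first exact: regular_perm.
rewrite addrAC; apply: (IH) => //.
move: (ge_regseq ge rs); rewrite extD ext_prin => rs'.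
rewrite -ss -(size_map phi); apply: depth_regseq => // _ /mapP[x /sm mx ->].
exact: ext_mem.
Qed.

(* An associated prime of A/J has dimension at least the depth of A/J. *)
Lemma depth_annihilator N (A : comPzRingType) (m J c : ideal A) z ys r : local_noeth m ->
  depth_ge N.+1 m J -> ~ J z -> (forall x, c x -> J (x * z)) ->
  size ys = N -> (forall y, y \in ys -> m y) -> m ^+ r <<= c + spans ys -> False.
Proof.
elim: N A m J c z ys => [|N IH] A0 m0 J0 c0 z0 ys0 lA0 d0 nz0 hz0.
  move=> /size0nil -> _; rewrite spans_nil addr0 => mc.
  by apply: nz0; apply: (depth_socleX (r := r) lA0 d0) => a /mc/hz0.
case: ys0 => [//|y0 ys0] [sy0] my0 mr0.
case: d0 => A [phi0 [s [ge0 ss sm rs]]].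
have lA := ge_ln ge0.
have nz : ~ extI phi0 J0 (phi0 z0) by move/(ge_faithful lA0 ge0).
have hz x : extI phi0 c0 x -> extI phi0 J0 (x * phi0 z0).
  suff h : extI phi0 c0 <<= colon (extI phi0 J0) [set phi0 z0] by move=> /h/colon1P; rewrite mulrC.
  by apply/ext_le => a /hz0 h; apply/colon1P; rewrite mulrC -rmorphM; exact: ext_mem.
have mr := @ext_mono _ _ phi0 _ _ mr0; rewrite extX extD ext_spans /= in mr.
have my : extI phi0 m0 (phi0 y0) by apply: ext_mem; apply: my0; exact: mem_head.
have mys y : y \in map phi0 ys0 -> extI phi0 m0 y.
  by move=> /mapP[x xs ->]; apply: ext_mem; apply: my0; rewrite inE xs orbT.
have sy : size (map phi0 ys0) = N by rewrite size_map.
move: (extI phi0 J0) (extI phi0 m0) (extI phi0 c0) (phi0 z0) (phi0 y0) (map phi0 ys0) nz hz mr my mys sy lA sm rs.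
move=> J m c z y ys nz hz mr my mys sy lA sm rs {lA0 nz0 hz0 my0 mr0 ge0 sy0}.
have [B [phi [T [ge _ gen]]]] := generic_ext lA.
have [f mf] := ln_noeth lA (m ^+ r.+1).
have mf' : m ^+ r.+1 <<= spans f by rewrite {1}mf.
(* A generic perturbation of y by m^(r+1): regular modulo J, and close enough to y for Nakayama's
   lemma below. *)
pose w := \sum_(i < size (y :: f)) phi (y :: f)`_i * T ^+ i.
have mf2 x : x \in f -> x \ini m ^+ r.+1 by move=> xf; rewrite mf; exact: spans_mem.
have mf1 x : x \in f -> m x by move=> /mf2; rewrite exprS; exact: ileMr.
have dJ := depth_regseq lA sm rs; rewrite ss in dJ.
have rw : regular (extI phi J) w.
  apply: gen => u hu; apply: (depth_socleX (r := r.+1) lA dJ).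
  by apply: annihilator_spans mf' _ => x xf; apply: hu; rewrite inE xf orbT.
have mw : extI phi m w.
  apply: ideal_sum => i _; apply: idealMr; apply: ext_mem.
  by have := mem_nth 0 (ltn_ord i); rewrite inE => /predU1P[->|/mf1].
have lB := ge_ln ge.
have dJB : depth_ge N.+1 (extI phi m) (extI phi J + prin w).
  apply: depth_exchange => //; rewrite -ss -(size_map phi).
  by apply: depth_regseq (ge_regseq ge rs) => // _ /mapP[x /sm mx ->]; exact: ext_mem.
(* Otherwise (J : c) lies in J + w (J : c), and Nakayama's lemma puts z into J. *)
have [z' nz' hz'] : exists2 z', ~ (z' \ini extI phi J + prin w) &
    forall x, extI phi c x -> x * z' \ini extI phi J + prin w.
  apply: contrapT => nex; apply: nz; apply: (ge_faithful lA ge).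
  suff : colon (extI phi J) (extI phi c) <<= extI phi J.
    apply=> x; suff h : extI phi c <<= colon (extI phi J) [set phi z] by move=> /h/colon1P; rewrite mulrC.
    by apply/ext_le => a /hz h; apply/colon1P; rewrite mulrC -rmorphM; exact: ext_mem.
  apply: (nakayama_eq lB mw) => u hu.
  have /memDprin[t Jt] : u \ini extI phi J + prin w.
    by apply: contrapT => nu; apply: nex; exists u => // x /hu; exact: ileDl.
  rewrite -[u](subrK (t * w)); apply: memD2 => //; rewrite [t * w]mulrC.
  apply: ideal_mul_mem; first exact: prin_mem.
  move=> x cx; apply: rw.
  have := idealB (hu x cx) (idealMl x Jt); congr (extI phi J _); ring.
apply: (IH B (extI phi m) (extI phi J + prin w) (extI phi c + prin w) z' (map phi ys)) => //.
- move=> _ [x [_ [cx /prinP[t ->] ->]]]; rewrite mulrDl; apply: idealD; first exact: hz'.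
  by apply: idealMr; apply: idealMl; apply: ileDr; exact: prin_mem.
- by rewrite size_map.
- by move=> _ /mapP[x /mys mx ->]; exact: ext_mem.
(* m^r lies in c + (y, ys), and y agrees modulo m m^r with w. *)
apply: (nakayama lB); apply: ile_trans (_ : extI phi (c + spans (y :: ys)) <<= _).
  by rewrite -extX; exact: ext_mono.
rewrite extD ext_spans map_cons spans_cons addrA -exprS.
apply: ileD; last first.
  by apply: ile_trans (@ileDl _ _ _); exact: ileDr.
apply: ileD; first by do 2 apply: ile_trans (@ileDl _ _ _); exact: ileDl.
apply/prin_le.
have -> : phi y = w - \sum_(i < size f) phi f`_i * T ^+ i.+1.
  by rewrite /w /= big_ord_recl /= expr0 mulr1 addrK.
apply: idealB; first by do 2 apply: ileDl; apply: ileDr; exact: prin_mem.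
apply: ileDr; apply: ideal_sum => i _; apply: idealMr.
by rewrite -extX; apply: ext_mem; apply: mf2; exact: mem_nth.
Qed.

(** If a y is in J but y is not, then (J : y) contains J and a, so the N elements s already cut A/(J
    : y) down to finite length, against [depth_annihilator]. *)
Lemma sop_regular N (A : comPzRingType) (m J : ideal A) a s r : local_noeth m ->
  depth_ge N.+1 m J -> size s = N -> m a -> (forall x, x \in s -> m x) ->
  m ^+ r <<= J + prin a + spans s -> regular J a.
Proof.
move=> lA dJ ss ma ms mr y Jay; apply: contrapT => nJy.
apply: (@depth_annihilator N A m J (colon J [set y]) y s r lA dJ nJy) => //.
  by move=> x /colon1P; rewrite mulrC.
apply: ile_trans mr _; apply: ileD2 => //; apply: ileD; first exact: ile_colon.
by apply/prin_le/colon1P; rewrite mulrC.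
Qed.

End Depth.

(** * Parameter ideals *)

Section ParameterIdeals.
Variables (A : comPzRingType) (m : ideal A).
Hypothesis lA : local_noeth m.
Implicit Types (I J K : ideal A) (s : seq A).

(** A multiple of y in J + (y, S)^(n+1) differs from an element of y (y, S)^n by one of J + S^(n+1),
    where y can be cancelled. *)
Lemma power_colon J S y n : regular (J + S ^+ n.+1) y ->
  colon (J + (prin y + S) ^+ n.+1) [set y] = J + (prin y + S) ^+ n.
Proof.
move=> ry; apply: ideal_le_anti => u.
  move=> /colon1P[j [v [Jj /addXS_le[x [w [hx Sw ev]]] e]]]; rewrite {}ev in e.
  have [t ht et] : exists2 t, t \ini (prin y + S) ^+ n & x = t * y.
    by apply/memMprin; rewrite mulrC.
  rewrite {}et in e; rewrite -[u](subrK t); apply: idealD; last exact: ileDr.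
  have : u - t \ini J + S ^+ n.+1.
    by apply: ry; exists j, w; split=> //; rewrite mulrBr e; ring.
  by apply: ileD2 => //; apply: ile_trans (@ileXX _ _ _ _ (leqnSn n)) _; apply: ileX2; exact: ileDr.
move=> [j [v [Jj hv ->]]]; apply/colon1P; rewrite mulrDr; apply: memD2; first exact: idealMl.
by rewrite exprS; apply: ideal_mul_mem => //; apply: ileDl; exact: prin_mem.
Qed.

(** Induction on N, then on n, splitting off one parameter y of s: modulo y the case N applies, and
    multiples of y are handled by [power_colon]. *)
Lemma sop_regular_power N J a s r n : depth_ge N.+1 m J -> size s = N ->
  m a -> (forall x, x \in s -> m x) -> m ^+ r <<= J + prin a + spans s ->
  regular (J + spans s ^+ n) a.
Proof.
elim: N J a s r n => [|N IH] J a [|y s] r n //= dJ.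
  move=> _ ma ms mr; rewrite spans_nil.
  case: n => [|n]; last by rewrite exprS mul0r addr0; apply: sop_regular dJ _ ma ms mr.
  by move=> x _; exact: ileDr.
move=> [ss] ma ms mr.
have my : m y by apply: ms; exact: mem_head.
have {}ms x : x \in s -> m x by move=> xs; apply: ms; rewrite inE xs orbT.
rewrite spans_cons in mr; rewrite spans_cons.
have ra : regular J a.
  apply: (sop_regular (s := y :: s) (r := r) lA dJ) => //=; first by rewrite ss.
    by move=> x; rewrite inE => /predU1P[->|/ms].
  by rewrite spans_cons.
have ry : regular J y.
  apply: (sop_regular (s := a :: s) (r := r) lA dJ) => //=; first by rewrite ss.
    by move=> x; rewrite inE => /predU1P[->|/ms].
  by rewrite spans_cons addrACA.
(* Modulo every a^(j+1), y is regular by induction on N; Krull's theorem then removes a^(j+1). *)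
have ryX k : regular (J + spans s ^+ k) y.
  move=> z hz; apply: (krull_prin lA ma) => -[|j].
    by rewrite expr0; apply: ileDr; rewrite -[z]mulr1; apply: idealMl; exact: prin_mem.
  have : z \ini J + prin (a ^+ j.+1) + spans s ^+ k.
    apply: (IH _ y _ (r * j.+1)%N _ _ ss) => //.
    - by apply: depth_exchange => //; [rewrite exprS; exact: idealMr|exact: regularX].
    - rewrite exprM; apply: ile_trans (@ileX2 _ _ _ j.+1 mr) _.
      have -> : J + prin a + (prin y + spans s) = J + prin y + spans s + prin a.
        by rewrite addrAC !addrA.
      by rewrite prinX -[X in _ <<= X]addrA (addrAC J (prin a ^+ _)) addrA; exact: addX_le1.
    - by move: hz; apply: ileD2 => //; exact: ileDl.
  by rewrite addrAC.
elim: n => [|n IHn]; first by move=> x _; exact: ileDr.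
move=> z haz.
have le1 : J + (prin y + spans s) ^+ n.+1 <<= J + prin y + spans s ^+ n.+1.
  rewrite -addrA; apply: ileD2 => //; apply: ile_trans (@addXS_le _ _ _ _) _.
  by apply: ileD2 => //; exact: ileMr.
have : z \ini J + prin y + spans s ^+ n.+1.
  apply: (IH _ a _ r _ _ ss) => //; [exact: depth_exchange| |exact: le1].
  by rewrite -(addrA (J + _)) addrACA.
(* With q = (y, s), z is t y modulo J + q^(n+1). So a t y is in J + q^(n+1), a t is in J + q^n, and
   induction on n applies to t. *)
rewrite addrAC => /memDprin[t ht].
have ht' : z - t * y \ini J + (prin y + spans s) ^+ n.+1.
  by move: ht; apply: ileD2 => //; apply: ileX2; exact: ileDr.
have yt : y * t \ini J + (prin y + spans s) ^+ n.+1 -> z \ini J + (prin y + spans s) ^+ n.+1.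
  by rewrite [y * t]mulrC => h; rewrite -[z](subrK (t * y)); exact: idealD.
apply: yt; apply/colon1P; rewrite power_colon//; apply: IHn; rewrite -(power_colon (ryX n.+1)).
apply/colon1P; have := idealB haz (idealMl a ht'); congr (_ \ini _); ring.
Qed.


(** With q = (a, S), the colon of J + q^(n+2) by a is J + q^(n+1), and adding a gives J + (a) +
    S^(n+2); the two lengths add up by Pascal's rule. *)
Lemma sop_length N J s r e n : depth_ge N m J -> size s = N -> (forall x, x \in s -> m x) ->
  m ^+ r <<= J + spans s -> has_len m (J + spans s) e ->
  has_len m (J + spans s ^+ n.+1) (e * 'C(n + N, N)).
Proof.
elim: N J s e r n => [|N IH] J [|a s] e r n //= dJ.
  by move=> _ _ _; rewrite spans_nil exprS mul0r addr0 bin0 muln1.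
move=> [ss] ms mr he.
have ma : m a by apply: ms; exact: mem_head.
have {}ms x : x \in s -> m x by move=> xs; apply: ms; rewrite inE xs orbT.
rewrite spans_cons addrA in mr.
have rX k : regular (J + spans s ^+ k) a by apply: (sop_regular_power (n := k) dJ ss ma ms mr).
have ra : regular J a by apply: sop_regular dJ ss ma ms mr.
rewrite spans_cons in he *.
elim: n => [|n IHn]; first by rewrite expr1 add0n binn muln1.
rewrite addSn addnS binS mulnDr -addnS; apply: (has_len_colon (f := a)).
  by rewrite power_colon.
have -> : J + (prin a + spans s) ^+ n.+2 + prin a = J + prin a + spans s ^+ n.+2.
  apply: ideal_le_anti.
    rewrite addrAC; apply: ileD; first exact: ileDl.
    apply: ile_trans (@addX_le1 _ _ _ _) _; apply: ileD2 => //; exact: ileDr.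
  rewrite [X in _ <<= X]addrAC; apply: ileD2 => //; apply: ileX2; exact: ileDr.
rewrite addnS -addSn.
apply: (IH _ _ _ r) => //; first exact: depth_exchange.
by rewrite -addrA.
Qed.

End ParameterIdeals.

(** * Dimension and growth of the Hilbert-Samuel function *)

Section Dimension.
Variables (A : comPzRingType) (m : ideal A).
Hypothesis lA : local_noeth m.
Implicit Types (I J K P Q : ideal A).

Definition prime_chain K l := ideal_chain (fun P => prime_ideal P /\ K <<= P) l.
Definition dim_le K n := forall l, prime_chain K l -> (l <= n)%N.

Lemma prime_chain_mono K K' l : K <<= K' -> prime_chain K' l -> prime_chain K l.
Proof.
move=> KK' [c [hc lc]]; exists c; split=> // i /hc[pc K'c]; split=> //; exact: ile_trans K'c.
Qed.

Lemma dim_le_mono K K' n : K <<= K' -> dim_le K n -> dim_le K' n.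
Proof. by move=> KK' h l /(prime_chain_mono KK')/h. Qed.

Lemma prime_chain_cons K K' l : K <<= K' ->
  (forall P, prime_ideal P -> K' <<= P -> exists2 Q', prime_ideal Q' & K <<= Q' /\ (Q' : set A) `<` P) ->
  prime_chain K' l -> prime_chain K l.+1.
Proof.
move=> KK' next [c [hc lc]].
have [pc0 K'c0] := hc 0%N (leq0n _); have [Q' pQ' [KQ' Q'c]] := next _ pc0 K'c0.
exists (fun i => if i is j.+1 then c j else Q'); split=> [[|i] li|[|i] li] //.
  by have [? ?] := hc i li; split=> //; exact: ile_trans KK' _.
exact: lc.
Qed.

Lemma prime_m : prime_ideal m.
Proof.
split=> [e|x y mxy]; first by apply: (ln_proper lA); rewrite e.
have [mx|/(ln_unit lA)[u ux]] := pselect (m x); [by left|right].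
by rewrite -[y]mul1r -ux -mulrA; exact: idealMl.
Qed.

(* A prime minimal over J consists of zero divisors modulo J. *)
Lemma prime_below_regular J f P : regular J f -> prime_ideal P -> J + prin f <<= P ->
  exists2 Q, prime_ideal Q & J <<= Q /\ (Q : set A) `<` P.
Proof.
move=> rf [P1 Pp] JfP; have nP1 : ~ P 1 by move/mem_one.
(* I avoids the multiplicative set of all s f^k with s outside P; an ideal maximal for this is
   prime. *)
pose T I := forall s k, ~ P s -> ~ I (s * f ^+ k).
have [|Q [JQ TQ maxQ]] := noeth_max (ln_noeth lA) (P := T) (I := J).
  move=> s k nPs; rewrite mulrC => /(regularX rf) Js; apply: nPs.
  by apply: JfP; exact: ileDl.
have Qle x : ~ Q x -> exists s k, ~ P s /\ (s * f ^+ k) \ini Q + prin x.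
  move=> nQx; apply: contrapT => nex; apply: nQx.
  rewrite -(maxQ (Q + prin x) (@ileDl _ _ _)); first by apply: ileDr; exact: prin_mem.
  by move=> s k nPs h; apply: nex; exists s, k.
exists Q; last split=> //.
  split=> [e|x y Qxy]; first by apply: (TQ 1 0%N nP1); rewrite e.
  apply: contrapT => /not_orP[/Qle[s [k [nPs hx]]] /Qle[t [l [nPt hy]]]].
  apply: (TQ (s * t) (k + l)%N); first by case/Pp.
  have -> : s * t * f ^+ (k + l) = (s * f ^+ k) * (t * f ^+ l) by rewrite exprD; ring.
  case: hx hy => [q [_ [Qq /prinP[a ->] ->]]] [r [_ [Qr /prinP[b ->] ->]]].
  have -> : (q + a * x) * (r + b * y) = q * (r + b * y) + (a * x * r + a * b * (x * y)) by ring.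
  by apply: idealD; [exact: idealMr|apply: idealD; exact: idealMl].
apply/ideal_ltP; split=> [q Qq|].
  by apply: contrapT => nPq; apply: (TQ q 0%N nPq); rewrite expr0 mulr1.
exists f; first by apply: JfP; apply: ileDr; exact: prin_mem.
by move=> Qf; apply: (TQ 1 1%N nP1); rewrite mul1r expr1.
Qed.

Lemma prime_chain_regular J f l : regular J f -> prime_chain (J + prin f) l -> prime_chain J l.+1.
Proof.
move=> rf; apply: prime_chain_cons (@ileDl _ _ _) _.
by move=> P pP JfP; exact: prime_below_regular JfP.
Qed.

Definition growth_le K n := exists C, forall j l, has_len m (K + m ^+ j) l -> (l <= C * j ^ n)%N.

Lemma len_exists K j : exists l, has_len m (K + m ^+ j) l.
Proof. by apply: (has_len_exists lA (r := j)); exact: ileDr. Qed.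

Lemma len_split K a j l : has_len m (K + m ^+ j) l -> exists p q,
  [/\ has_len m (colon (K + m ^+ j) [set a]) p, has_len m (K + prin a + m ^+ j) q & (l = p + q)%N].
Proof.
move=> hl; have [p hp] : exists p, has_len m (colon (K + m ^+ j) [set a]) p.
  apply: (has_len_exists lA (r := j)); apply: ile_trans (@ile_colon _ _ _); exact: ileDr.
have [q hq] := len_exists (K + prin a) j; exists p, q; split=> //.
by apply: (has_len_uniq lA hl); apply: (has_len_colon hp); rewrite addrAC.
Qed.

(** For a in m outside K, the colon of K + m^(j+1) by a contains K + m^j, so from j to j + 1 the
    length grows by at most the bound C (j + 1)^(n-1) for K + (a). The prime K prolongs every chain
    of primes over K + (a), so the dimension drops. *)
Lemma growth_prime K n : (forall K', (0 < n)%N -> dim_le K' n.-1 -> growth_le K' n.-1) ->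
  prime_ideal K -> dim_le K n -> growth_le K n.
Proof.
move=> IHn pK dK; have nK1 : ~ K 1 by move/mem_one; exact: pK.1.
have Km := proper_le_m lA nK1.
have [mK|nmK] := pselect (m <<= K).
  have -> : K = m by exact: ideal_le_anti.
  exists 1%N => -[|j] l hl; rewrite mul1n.
    have : has_len m (m + m ^+ 0) 0.
      suff -> : m + m ^+ 0 = 1 by exact: has_len_unit.
      by apply/mem_one; exact: ileDr.
    by move=> /(has_len_uniq lA hl) ->.
  suff : has_len m (m + m ^+ j.+1) 1 by move=> /(has_len_uniq lA hl) ->; rewrite expn_gt0.
  rewrite ile_add_sub; last by rewrite exprS; exact: ileMr.
  apply: (@has_len_step _ _ _ 1); [exact: ln_proper lA|by move=> a; rewrite mulr1|].
  suff -> : m + prin 1 = 1 by exact: has_len_unit.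
  by apply/mem_one; apply: ileDr; exact: prin_mem.
have [a ma nKa] : exists2 a, m a & ~ K a.
  by apply: contrapT => h; apply: nmK => a ma; apply: contrapT => nKa; apply: h; exists a.
have ngt0 : (0 < n)%N.
  apply: dK; exists (fun i => if i is 0%N then K else m); split=> [[|i] _|[|i]//] /=.
  - by split.
  - by split=> //; exact: prime_m.
have dKa : dim_le (K + prin a) n.-1.
  move=> l hl; suff : (l.+1 <= n)%N by move: ngt0; lia.
  apply: dK; apply: prime_chain_cons (@ileDl _ _ _) _ hl.
  move=> P pP KaP; exists K => //; split=> //; apply/ideal_ltP; split; first exact: ile_trans (@ileDl _ _ _) KaP.
  by exists a => //; apply: KaP; apply: ileDr; exact: prin_mem.
have [C hC] := IHn _ ngt0 dKa.
exists C; elim=> [|j IHj] l hl.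
  have : has_len m (K + m ^+ 0) 0.
    suff -> : K + m ^+ 0 = 1 by exact: has_len_unit.
    by apply/mem_one; exact: ileDr.
  by move=> /(has_len_uniq lA hl) ->.
have [p [q [hp hq ->]]] := len_split a hl.
have [l' hl'] := len_exists K j.
have lep : (p <= l')%N.
  apply: (has_len_le lA _ hl' hp) => u [k [v [Kk mv ->]]]; apply/colon1P; rewrite mulrDr.
  by apply: memD2; [exact: idealMl|rewrite exprS; exact: ideal_mul_mem].
rewrite -(prednK ngt0) expnS mulSn mulnDr addnC; apply: leq_add; first exact: hC.
apply: leq_trans lep (leq_trans (IHj _ hl') _).
rewrite -{1}(prednK ngt0) expnS !leq_mul2l.
by case: (n.-1) => [|n']; rewrite ?leqnn ?orbT // leq_exp2r// leqnSn !orbT.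
Qed.

(** If a b is in K with a and b outside K, then K + (a) and (K : a) are strictly larger, and their
    lengths bound that of K. *)
Lemma growth_noeth K n : (forall K', (0 < n)%N -> dim_le K' n.-1 -> growth_le K' n.-1) ->
  dim_le K n -> growth_le K n.
Proof.
move=> IHn; elim/(noeth_ind (ln_noeth lA)): K => K IHK dK.
have [pK|npK] := pselect (prime_ideal K); first exact: growth_prime.
have [/mem_one ->|nK1] := pselect (K 1).
  exists 0%N => j l hl; rewrite (has_len_uniq lA hl (l' := 0)) //.
  suff -> : 1 + m ^+ j = 1 by exact: has_len_unit.
  by apply/mem_one; exact: ileDl.
have [a [b [Kab nKa nKb]]] : exists a b, [/\ K (a * b), ~ K a & ~ K b].
  apply: contrapT => h; apply: npK; split=> [e|x y Kxy]; first by apply: nK1; rewrite e.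
  by apply: contrapT => /not_orP[nx ny]; apply: h; exists x, y.
have nKKa : K <> K + prin a by move=> e; apply: nKa; rewrite e; apply: ileDr; exact: prin_mem.
have nKKb : K <> colon K [set a] by move=> e; apply: nKb; rewrite e; apply/colon1P.
have [C1 h1] := IHK _ (@ileDl _ _ _) nKKa (dim_le_mono (@ileDl _ _ _) dK).
have [C2 h2] := IHK _ (@ile_colon _ _ _) nKKb (dim_le_mono (@ile_colon _ _ _) dK).
exists (C1 + C2)%N => j l /(len_split a)[p [q [hp hq ->]]].
have [l' hl'] := len_exists (colon K [set a]) j.
have lep : (p <= l')%N.
  apply: (has_len_le lA _ hl' hp); apply: ileD; first by apply: ile_colon2; exact: ileDl.
  by apply: ile_trans (@ile_colon _ _ _); exact: ileDr.
by have := h1 _ _ hq; have := h2 _ _ hl'; rewrite mulnDl; move: lep; lia.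
Qed.

Lemma growth_dim K n : dim_le K n -> growth_le K n.
Proof. by elim: n K => [|n IHn] K; apply: growth_noeth => // K' _; exact: IHn. Qed.

End Dimension.

(** * Reductions *)

Lemma leq_expr_r a b e : (a <= b)%N -> (a ^ e <= b ^ e)%N.
Proof. by case: e => [//|e]; rewrite leq_exp2r. Qed.

Section Monomials.
Variables (A : comPzRingType) (t : nat).
Hypothesis t_gt0 : (0 < t)%N.
Implicit Types (s : seq A) (k : nat).

(* The exponents of the monomial with label k are the digits of k in base t, so *)
(* that the substitution s`_i = T^(t^i) h sends it to T^k times a power of h. *)
Fixpoint mon s k : A := if s is g :: s' then g ^+ (k %% t) * mon s' (k %/ t) else 1.
Fixpoint mdeg s k : nat := if s is g :: s' then (k %% t + mdeg s' (k %/ t))%N else 0.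

Lemma mdeg_le s k : (mdeg s k <= size s * t)%N.
Proof.
elim: s k => [//|g s IH] k /=; rewrite mulSn leq_add//.
by rewrite ltnW// ltn_pmod.
Qed.

Lemma mem_mon s k (b : ideal A) : spans s <<= b -> mon s k \ini b ^+ mdeg s k.
Proof.
elim: s k => [|g s IH] k /= sb; first by rewrite expr0.
rewrite exprD; apply: ideal_mul_mem; first by apply: memX; apply: sb; apply: spans_mem; exact: mem_head.
by apply: IH; apply: ile_trans sb; rewrite spans_cons; exact: ileDr.
Qed.

End Monomials.

Section Relation.
Variables (A : comPzRingType) (m : ideal A).
Hypothesis lA : local_noeth m.
Variables (K : ideal A) (s : seq A) (h : A).
Hypotheses (sm : forall x, x \in s -> m x) (mh : m h).

Let b : ideal A := prin h + spans s.
(** The monomial with label k, made homogeneous of degree j by h once j is at least its degree. *)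
Definition hmon t j k := mon t s k * h ^+ (j - mdeg t s k).

Lemma mem_hmon t j k : (0 < t)%N -> (size s * t <= j)%N -> hmon t j k \ini b ^+ j.
Proof.
move=> t0 lej; rewrite -[j in b ^+ j](subnKC (leq_trans (mdeg_le t0 s k) lej)) exprD.
apply: ideal_mul_mem; first by apply: mem_mon; exact: ileDr.
by apply: memX; apply: ileDl; exact: prin_mem.
Qed.

(** Modulo K + m b^j, a form with top label k and leading coefficient 1 vanishes. *)
Definition hmon_related t j k :=
  hmon t j k \ini K + m * b ^+ j + spans [seq hmon t j i | i <- iota 0 k].

(** Without relations, adding the monomials one by one gives t^N strict steps from K + m b^j up to K
    + b^j, where N is the size of s. *)
Lemma chain_from_hmon t j q : (0 < t)%N -> (size s * t <= j)%N ->
  (forall k, (k < t ^ size s)%N -> ~ hmon_related t j k) ->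
  chain_from (K + b ^+ j) q -> chain_from (K + b ^+ j.+1) (t ^ size s + q).
Proof.
move=> t0 lej nrel hq; have bm : b <<= m by apply: ileD; [apply/prin_le|apply/spans_le].
apply: (@chain_from_mono _ _ (K + m * b ^+ j)).
  by apply: ileD2 => //; rewrite exprS; exact: ileM2.
suff H i : (i <= t ^ size s)%N ->
    chain_from (K + m * b ^+ j + spans [seq hmon t j i | i <- iota 0 (t ^ size s - i)]) (i + q).
  by have := H _ (leqnn _); rewrite subnn /= spans_nil addr0.
elim: i => [_|i IHi lti].
  apply: chain_from_mono hq; apply: ileD.
    by apply: ileD2 => //; exact: ileMl.
  by apply/spans_le => _ /mapP[k _ ->]; apply: ileDr; exact: mem_hmon.
rewrite addSn; set k := (t ^ size s - i.+1)%N.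
exists (K + m * b ^+ j + spans [seq hmon t j i | i <- iota 0 (t ^ size s - i)]); split; last by apply: IHi; exact: ltnW.
  apply: ileD2 => //; apply/spans_le => _ /mapP[l lk ->]; apply: spans_mem; apply: map_f.
  by move: lk; rewrite !mem_iota /k; lia.
exists (hmon t j k); last by apply: nrel; rewrite /k; lia.
apply: ileDr; apply: spans_mem; apply: map_f; rewrite mem_iota /k; lia.
Qed.

(* There are t^N monomials of each degree j >= N t, too many to be independent. *)
Lemma hmon_relation n C c0 : (n <= size s)%N ->
  (forall j l, has_len m (K + b ^+ j.+1) l -> (l <= C * j.+1 ^ n)%N) ->
  (forall i, m ^+ (i + c0) <<= K + b ^+ i) ->
  exists t j k, [/\ (0 < t)%N, (size s * t <= j)%N, (0 < j)%N, (k < t ^ size s)%N & hmon_related t j k].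
Proof.
move=> leN growth red; set N := size s.
(* Chosen so that t degrees with t^N steps each exceed the bound C ((N + 2) t)^N. *)
pose t := (C * (N + 2) ^ N).+1; apply: contrapT => nex.
have H i : chain_from (K + b ^+ (N * t + i).+1) (i * t ^ N).
  elim: i => [//|i IHi]; rewrite mulSn addnS; apply: chain_from_hmon IHi => //.
    by rewrite -/N; lia.
  move=> k ltk rel; apply: nex; exists t, (N * t + i).+1, k; split=> //; rewrite -/N; lia.
have [l hl] := has_len_exists lA (red (N * t + t).+1).
have le1 : ((N * t + t).+1 ^ n <= ((N + 2) * t) ^ N)%N.
  apply: leq_trans (leq_pexp2l _ leN) _ => //.
  by apply: leq_expr_r; rewrite mulnDl /t; lia.
have := leq_trans (has_len_max lA hl (H t)) (growth _ _ hl).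
move=> /leq_trans/(_ (leq_mul (leqnn C) le1)).
by rewrite expnMn mulnA leq_pmul2r ?expn_gt0// /t ltnn.
Qed.

End Relation.

Section Twist.
Variables (A B : comPzRingType) (phi : {rmorphism A -> B}) (T : B) (h : A) (t : nat).
Variables (b c : ideal B).
Hypothesis bh : b (phi h).

(** Kronecker's substitution: starting from q = 1, modulo these elements the i-th member of s
    becomes T^(t^i) h. *)
Fixpoint twist q (s : seq A) : seq B :=
  if s is g :: s' then (phi g - T ^+ q * phi h) :: twist (q * t)%N s' else [::].

Lemma size_twist q s : size (twist q s) = size s.
Proof. by elim: s q => //= g s IH q; rewrite IH. Qed.

Lemma cong_mul d e x y u v : x - y \ini c * b ^+ d.-1 -> u - v \ini c * b ^+ e.-1 ->
  u \ini b ^+ e -> y \ini b ^+ d -> x * u - y * v \ini c * b ^+ (d + e).-1.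
Proof.
move=> xy uv be bd; have -> : x * u - y * v = (x - y) * u + (u - v) * y by ring.
apply: idealD.
  have : (x - y) * u \ini c * b ^+ d.-1 * b ^+ e by exact: ideal_mul_mem.
  by rewrite -mulrA -exprD; apply: ileM2 => //; apply: ileXX; lia.
have : (u - v) * y \ini c * b ^+ e.-1 * b ^+ d by exact: ideal_mul_mem.
by rewrite -mulrA -exprD; apply: ileM2 => //; apply: ileXX; lia.
Qed.

Lemma cong_exp g q r : phi g - T ^+ q * phi h \ini c -> b (phi g) ->
  phi g ^+ r - T ^+ (q * r) * phi h ^+ r \ini c * b ^+ r.-1.
Proof.
move=> hc bg; elim: r => [|r IH]; first by rewrite muln0 !expr0 !mulr1 subrr; exact: idealr0.
have -> : T ^+ (q * r.+1) * phi h ^+ r.+1 = (T ^+ q * phi h) * (T ^+ (q * r) * phi h ^+ r).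
  by rewrite mulnS exprD exprS; ring.
rewrite exprS; apply: (@cong_mul 1) => //.
- by rewrite expr0 mulr1.
- exact: memX.
- by rewrite expr1; exact: idealMl.
Qed.

(** The exponents of the monomial are the base t digits of k, so the exponents of T add up to q
    k. *)
Lemma cong_mon s q k : (0 < t)%N -> spans (twist q s) <<= c -> (forall g, g \in s -> b (phi g)) ->
  (k < t ^ size s)%N ->
  phi (mon t s k) - T ^+ (q * k) * phi h ^+ mdeg t s k \ini c * b ^+ (mdeg t s k).-1.
Proof.
move=> t_gt0; elim: s q k => [|g s IH] q k /=.
  by rewrite expn0 ltnS leqn0 => _ _ /eqP ->; rewrite muln0 !expr0 !mulr1 rmorph1 subrr; exact: idealr0.
rewrite spans_cons => hc hb ltk.
have bg : b (phi g) by apply: hb; exact: mem_head.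
have {}hb x : x \in s -> b (phi x) by move=> xs; apply: hb; rewrite inE xs orbT.
have lt' : (k %/ t < t ^ size s)%N by rewrite ltn_divLR// mulnC -expnS.
have IH' := IH (q * t)%N _ (ile_trans (@ileDr _ _ _) hc) hb lt'.
have -> : T ^+ (q * k) * phi h ^+ (k %% t + mdeg t s (k %/ t)) =
   (T ^+ (q * (k %% t)) * phi h ^+ (k %% t)) * (T ^+ (q * t * (k %/ t)) * phi h ^+ mdeg t s (k %/ t)).
  have -> : (q * k = q * (k %% t) + q * t * (k %/ t))%N.
    by rewrite {1}(divn_eq k t) mulnDr addnC -mulnA (mulnC t).
  by rewrite !exprD; ring.
rewrite rmorphM rmorphXn; apply: cong_mul => //.
- by apply: cong_exp => //; apply: hc; apply: ileDl; exact: prin_mem.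
- have hs : extI phi (spans s) <<= b by rewrite ext_spans; apply/spans_le => _ /mapP[x /hb ? ->].
  by have /(@ext_mem _ _ phi) := mem_mon t (k %/ t) (fun x (hx : spans s x) => hx); rewrite extX; apply: ileX2.
- by apply: idealMl; exact: memX.
Qed.

End Twist.

(** One generator is saved. Modulo c b^(j-1), with c the ideal of twisted elements, a relation with
    top label k says that a monic polynomial in T times h^j lies in K + m b^j. This polynomial is a
    unit, so h^j lies in K + m b^j + c b^(j-1), and Nakayama's lemma puts b^j into K + c b^(j-1). *)
Lemma reduction_step (A : comPzRingType) (m K : ideal A) (s : seq A) h n C c0 : local_noeth m ->
  (forall x, x \in s -> m x) -> m h -> (n <= size s)%N ->
  (forall j l, has_len m (K + (prin h + spans s) ^+ j.+1) l -> (l <= C * j.+1 ^ n)%N) ->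
  (forall i, m ^+ (i + c0) <<= K + (prin h + spans s) ^+ i) ->
  exists (B : comPzRingType) (phi : {rmorphism A -> B}) (s' : seq B) c1,
  [/\ good_ext phi m, size s' = size s, forall x, x \in s' -> extI phi m x &
   forall i, extI phi m ^+ (i + c1) <<= extI phi K + spans s' ^+ i].
Proof.
move=> lA sm mh len growth red.
have [t [j [k [t0 lej j0 ltk]]]] := hmon_relation lA sm mh len growth red.
rewrite /hmon_related; set b := prin h + spans s => rel.
have [B [phi [T [ge Tmonic _]]]] := generic_ext lA.
exists B, phi, (twist phi T h t 1 s); set c := spans _; set b' := extI phi b.
have bh : b' (phi h) by apply: ext_mem; apply: ileDl; exact: prin_mem.
have bs g : g \in s -> b' (phi g) by move=> gs; apply: ext_mem; apply: ileDr; exact: spans_mem.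
have cb' q : spans (twist phi T h t q s) <<= b'.
  elim: (s) bs q => [|g s0 IH] bs0 q /=; first by rewrite spans_nil; exact: zero_ideal_le.
  rewrite spans_cons; apply: ileD; last first.
    by apply: IH => x xs; apply: bs0; rewrite inE xs orbT.
  by apply/prin_le; apply: idealB; [apply: bs0; exact: mem_head|exact: idealMl].
have cb := cb' 1%N : c <<= b'.
have bc : b' <<= c + prin (phi h).
  rewrite /b' extD ext_prin; apply: ileD; first exact: ileDr.
  rewrite ext_spans /c; elim: (s) (1%N) => [|g s0 IH] q /=; first exact: ileDl.
  rewrite !spans_cons; apply: ileD.
    by apply/prin_le/memDprin; exists (T ^+ q) => //; apply: ileDl; exact: prin_mem.
  by apply: ile_trans (IH _) _; apply: ileD2 => //; exact: ileDr.
have hmonE i : (i < t ^ size s)%N -> phi (hmon s h t j i) - T ^+ i * phi h ^+ j \ini c * b' ^+ j.-1.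
  move=> lti; rewrite /hmon rmorphM rmorphXn.
  have led : (mdeg t s i <= j)%N by apply: leq_trans lej; exact: mdeg_le.
  suff : phi (mon t s i) * phi h ^+ (j - mdeg t s i) -
      T ^+ i * phi h ^+ (mdeg t s i) * phi h ^+ (j - mdeg t s i) \ini
      c * b' ^+ (mdeg t s i + (j - mdeg t s i)).-1.
    by rewrite -mulrA -exprD subnKC.
  apply: cong_mul; rewrite ?subrr; [|exact: idealr0|exact: memX|by apply: idealMl; exact: memX].
  by have := cong_mon (T := T) bh (q := 1) t0 (fun x hx => hx) bs lti; rewrite mul1n.
pose E := extI phi K + extI phi m * b' ^+ j + c * b' ^+ j.-1.
have hj : phi h ^+ j \ini E.
  case: rel => [x [y [hx /spansP[a ey] e]]].
  have [u uT] := Tmonic k a.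
  rewrite -[_ ^+ j]mul1r -uT -mulrA; apply: idealMl.
  rewrite size_map size_iota in ey.
  have -> : (T ^+ k - \sum_(i < k) phi (a i) * T ^+ i) * phi h ^+ j =
     phi x - (phi (hmon s h t j k) - T ^+ k * phi h ^+ j) +
     \sum_(i < k) phi (a i) * (phi (hmon s h t j i) - T ^+ i * phi h ^+ j).
    have E1 : phi y = \sum_(i < k) phi (a i) * phi (hmon s h t j i).
      rewrite ey rmorph_sum; apply: eq_bigr => i _.
      by rewrite rmorphM (nth_map 0%N) ?size_iota// nth_iota.
    have -> : \sum_(i < k) phi (a i) * (phi (hmon s h t j i) - T ^+ i * phi h ^+ j) =
        phi y - (\sum_(i < k) phi (a i) * T ^+ i) * phi h ^+ j.
      by rewrite E1 mulr_suml -sumrB; apply: eq_bigr => i _; ring.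
    by rewrite e rmorphD; ring.
  apply: idealD.
    apply: idealB; last by apply: ileDr; exact: hmonE.
    by apply: ileDl; move: hx => /(@ext_mem _ _ phi); rewrite extD extM extX.
  by apply: ideal_sum => i _; apply: idealMl; apply: ileDr; apply: hmonE; exact: ltn_trans ltk.
have bj : b' ^+ j <<= extI phi K + c * b' ^+ j.-1.
  apply: (nakayama (ge_ln ge)); rewrite [X in _ <<= X]addrAC.
  have bE : b' = c + prin (phi h).
    by apply: ideal_le_anti => //; apply: ileD => //; apply/prin_le.
  rewrite -{1}(prednK j0) {1}bE; apply: ile_trans (@addXS_le _ _ _ _) _.
  apply: ileD; first by rewrite -bE; exact: ileDr.
  by rewrite (prednK j0) -prinX; apply/prin_le.
have step i : b' ^+ (i + j.-1) <<= extI phi K + c ^+ i.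
  suff : b' ^+ (i + j.-1) <<= extI phi K + c ^+ i * b' ^+ j.-1.
    by move=> H; apply: ile_trans H _; apply: ileD2 => //; exact: ileMr.
  elim: i => [|i IH]; first by rewrite expr0 mul1r; exact: ileDr.
  have -> : b' ^+ (i.+1 + j.-1) = b' ^+ i * b' ^+ j by rewrite -exprD; congr (_ ^+ _); lia.
  apply: ile_trans (@ileM2 _ _ _ _ _ (fun x hx => hx) bj) _.
  rewrite mulrDr; apply: ileD; first by apply: ile_trans (@ileDl _ _ _); exact: ileMl.
  rewrite mulrCA -exprD; apply: ile_trans (@ileM2 _ _ _ _ _ (fun x hx => hx) IH) _.
  by rewrite mulrDr mulrA -exprS; apply: ileD2 => //; exact: ileMl.
exists (j.-1 + c0)%N; split=> //; first exact: size_twist.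
  move=> x xs; have : b' x by apply: cb; exact: spans_mem.
  apply: ext_mono; apply: ileD; [exact/prin_le|exact/spans_le].
move=> i; rewrite addnA -extX; apply: ile_trans (@ext_mono _ _ phi _ _ (red _)) _.
by rewrite extD extX; apply: ileD; [exact: ileDl|exact: step].
Qed.

Lemma ext_growth (A B : comPzRingType) (phi : {rmorphism A -> B}) (m K : ideal A) n :
  local_noeth m -> good_ext phi m -> growth_le m K n -> growth_le (extI phi m) (extI phi K) n.
Proof.
move=> lA ge [C hC]; exists C => j l; rewrite -extX -extD => hl.
have [l' hl'] := len_exists lA K j.
by rewrite (has_len_uniq (ge_ln ge) hl (ge_len lA ge hl')); exact: hC.
Qed.

Lemma reduction_exists_aux p (A : comPzRingType) (m K : ideal A) (s : seq A) n c0 : local_noeth m ->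
  growth_le m K n -> size s = (n + p)%N -> (forall x, x \in s -> m x) ->
  (forall i, m ^+ (i + c0) <<= K + spans s ^+ i) ->
  exists (B : comPzRingType) (phi : {rmorphism A -> B}) (s' : seq B) c1,
  [/\ good_ext phi m, size s' = n, forall x, x \in s' -> extI phi m x &
   forall i, extI phi m ^+ (i + c1) <<= extI phi K + spans s' ^+ i].
Proof.
elim: p A m K s c0 => [|p IH] A m K s c0 lA gK.
  rewrite addn0 => ss sm red; exists A, idfun, s, c0; rewrite !extI_id; split=> //.
  exact: ge_id.
case: s => [|h s]; rewrite addnS // => -[ss] sm red.
have mh : m h by apply: sm; exact: mem_head.
have {}sm x : x \in s -> m x by move=> xs; apply: sm; rewrite inE xs orbT.
rewrite spans_cons in red; have [C hC] := gK.
have len : (n <= size s)%N by rewrite ss leq_addr.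
(* The new constant comes from (j + 1 + c0)^n <= (c0 + 1)^n (j + 1)^n. *)
have [|B [phi [s' [c1 [ge ss' sm' red']]]]] := reduction_step (C := C * c0.+1 ^ n) lA sm mh len _ red.
  move=> j l hl; have [l' hl'] := len_exists lA K (j.+1 + c0).
  have lel : (l <= l')%N.
    by apply: (has_len_le lA _ hl' hl); apply: ileD; [exact: ileDl|exact: red].
  apply: leq_trans lel (leq_trans (hC _ _ hl') _).
  rewrite -mulnA leq_mul2l -expnMn leq_expr_r ?orbT//; lia.
have [|C' [psi [s2 [c2 [ge2 ss2 sm2 red2]]]]] := IH B (extI phi m) (extI phi K) s' c1 (ge_ln ge) (ext_growth lA ge gK) _ sm' red'.
  by rewrite ss'.
exists C', (psi \o phi), s2, c2; rewrite !extI_comp; split=> //; exact: ge_comp.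
Qed.

Lemma reduction_exists (A : comPzRingType) (m K : ideal A) n : local_noeth m -> growth_le m K n ->
  exists (B : comPzRingType) (phi : {rmorphism A -> B}) (s : seq B) c,
  [/\ good_ext phi m, size s = n, forall x, x \in s -> extI phi m x &
   forall i, extI phi m ^+ (i + c) <<= extI phi K + spans s ^+ i].
Proof.
move=> lA gK; have [f mf] := ln_noeth lA m.
have mfx x : x \in f -> m x by move=> xf; rewrite mf; exact: spans_mem.
(* The zeros guarantee at least n generators. *)
apply: (@reduction_exists_aux (size f) A m K (nseq n 0 ++ f) n 0) => //.
- by rewrite size_cat size_nseq.
- by move=> x; rewrite mem_cat mem_nseq => /orP[/andP[_ /eqP ->]|/mfx//]; exact: idealr0.
- move=> i; rewrite addn0; apply: ile_trans (@ileDr _ _ _); apply: ileX2.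
  by rewrite spans_cat {1}mf; exact: ileDr.
Qed.

(** * Quotient rings and multiplicity *)

Lemma cvg_exp (R : archiRealFieldType) (f : nat -> R) (l : R) d :
  f @ \oo --> l -> (fun n => f n ^+ d) @ \oo --> l ^+ d.
Proof.
move=> fl; elim: d => [|d IH].
  by rewrite expr0; under eq_fun do rewrite expr0; exact: cvg_cst.
by rewrite exprS; under eq_fun do rewrite exprS; exact: cvgM.
Qed.

Lemma limn_squeeze_poly (R : archiRealFieldType) (e p q : R) (a : nat -> R^o) d :
  (\forall n \near \oo, e * (1 + p * n%:R^-1) ^+ d <= a n <= e * (1 + q * n%:R^-1) ^+ d) ->
  limn a = e.
Proof.
have H (c : R) : (fun n : nat => e * (1 + c * n%:R^-1) ^+ d) @ \oo --> e.
  have h0 : (fun n : nat => n%:R^-1 : R) @ \oo --> (0 : R).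
    by rewrite -(cvg_shiftS (fun n : nat => n%:R^-1 : R)); exact: cvg_harmonic.
  have h1 : (fun n : nat => 1 + c * n%:R^-1 : R) @ \oo --> (1 + c * 0 : R).
    by apply: cvgD; [exact: cvg_cst|apply: cvgM => //; exact: cvg_cst].
  have h2 : (fun n : nat => e * (1 + c * n%:R^-1) ^+ d) @ \oo --> e * (1 + c * 0) ^+ d.
    by apply: cvgM; [exact: cvg_cst|exact: cvg_exp].
  by rewrite mulr0 addr0 expr1n mulr1 in h2.
move=> h; apply: cvg_lim; first exact: norm_hausdorff.
exact: (squeeze_cvgr h (H p) (H q)).
Qed.

(** * Lengths, dimension and regular sequences along a surjection *)

Section Surjection.
Variables (R S : comPzRingType) (pi : {rmorphism R -> S}) (J : ideal R).
Hypothesis pi_surj : forall u, exists x, pi x = u.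
Hypothesis pi_ker : forall x, pi x = 0 <-> J x.
Implicit Types (I K : ideal R) (L : ideal S).

Lemma image_subproof I : is_ideal [set pi x | x in (I : set R)].
Proof.
split=> [|_ _ [x Ix <-] [y Iy <-]|u _ [x Ix <-]].
- by exists 0; [exact: idealr0|rewrite rmorph0].
- by exists (x + y); [exact: idealD|rewrite rmorphD].
- have [r <-] := pi_surj u.
  by exists (r * x); [exact: idealMl|rewrite rmorphM].
Qed.

Lemma ext_surj I u : extI pi I u -> exists2 x, I x & pi x = u.
Proof.
suff : extI pi I <<= Ideal (image_subproof I) by apply.
by apply/ext_le => x Ix; exists x.
Qed.

Lemma ext_surjP I y : extI pi I (pi y) <-> y \ini J + I.
Proof.
split=> [/ext_surj[x Ix e]|[j [x [/pi_ker j0 Ix ->]]]].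
  rewrite -[y](subrK x); apply: memD2 => //; apply/pi_ker.
  by rewrite rmorphB e subrr.
by rewrite rmorphD j0 add0r; exact: ext_mem.
Qed.

Lemma ext_ideal_surj I : J <<= I -> forall y, extI pi I (pi y) <-> I y.
Proof. by move=> JI y; rewrite ext_surjP addrC ile_add_sub. Qed.

Lemma ext_lt I I' : J <<= I -> (I : set R) `<` I' -> (extI pi I : set S) `<` extI pi I'.
Proof.
move=> JI /ideal_ltP[II' [x I'x nIx]]; apply/ideal_ltP; split; first exact: ext_mono.
by exists (pi x); [exact: ext_mem|rewrite (ext_ideal_surj JI)].
Qed.

Lemma pre_lt L L' : (L : set S) `<` L' -> (preI pi L : set R) `<` preI pi L'.
Proof.
move=> /ideal_ltP[LL' [u L'u nLu]]; have [x e] := pi_surj u.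
by apply/ideal_ltP; split=> [y /LL'//|]; exists x; rewrite /preI /ideal_set /= e.
Qed.

Lemma chain_from_ext K n : J <<= K -> chain_from K n -> exists c : nat -> ideal S,
  c 0%N = extI pi K /\ forall i, (i < n)%N -> (c i : set S) `<` c i.+1.
Proof.
elim: n K => [|n IH] K JK; first by exists (fun=> extI pi K).
move=> [K' [KK' lt /IH[|c [c0 hc]]]]; first exact: ile_trans KK'.
exists (fun i => if i is j.+1 then c j else extI pi K); split=> // -[_|i]; last exact: hc.
by rewrite c0; apply: ext_lt => //; apply/ideal_ltP.
Qed.

Lemma chain_from_pre (c : nat -> ideal S) n :
  (forall i, (i < n)%N -> (c i : set S) `<` c i.+1) -> chain_from (preI pi (c 0%N)) n.
Proof.
elim: n c => [//|n IH] c hc; exists (preI pi (c 1%N)).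
have /ideal_ltP[? ?] := pre_lt (hc 0%N (ltn0Sn _)); split=> //.
by apply: (IH (fun i => c i.+1)) => i lti; exact: hc.
Qed.

Lemma has_length_surj (m : ideal R) l : local_noeth m -> has_len m J l -> has_length S l.
Proof.
move=> lR hl; split.
  have [c [_ hc]] := chain_from_ext (fun x hx => hx) (has_len_chain hl).
  by exists c.
move=> n [c [_ hc]]; apply: (has_len_max lR hl); apply: chain_from_mono (chain_from_pre hc).
by move=> x /pi_ker e; rewrite /preI /ideal_set /= e; exact: idealr0.
Qed.

Lemma prime_ext P : J <<= P -> prime_ideal P -> prime_ideal (extI pi P).
Proof.
move=> JP [P1 Pp]; have H := ext_ideal_surj JP; split=> [e|u v].
  by apply: P1; apply/mem_one; rewrite -H e.
have [x <-] := pi_surj u; have [y <-] := pi_surj v.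
by rewrite -rmorphM !H; exact: Pp.
Qed.

Lemma dim_le_surj n : has_krull_dim S n -> dim_le J n.
Proof.
move=> [_ hn] l [c [hc lc]]; apply: hn; exists (fun i => extI pi (c i)); split=> i li.
  by have [? ?] := hc i li; exact: prime_ext.
by apply: ext_lt (lc i li); have [] := hc i (ltnW li).
Qed.

(** The prefix s1 holds the elements already divided out in the induction. *)
Lemma regseq_surj s1 s2 : regular_sequence (map pi (s1 ++ s2)) -> regseq (J + spans s1) s2.
Proof.
move=> [_ hs]; elim: s2 s1 hs => [//|a s2 IH] s1 hs /=; split.
  move=> y hy; rewrite -ext_surjP ext_spans.
  have := hs (size s1); rewrite !size_map size_cat /= addnS ltnS leq_addr => /(_ isT (pi y)).
  rewrite -map_take take_size_cat// (nth_map 0) ?size_cat ?addnS ?ltnS ?leq_addr//.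
  rewrite nth_cat ltnn subnn /=; apply.
  by rewrite -rmorphM -/(spans _) -ext_spans ext_surjP.
have -> : J + spans s1 + prin a = J + spans (rcons s1 a).
  by rewrite -cats1 spans_cat spans_cons spans_nil addr0 addrA.
by apply: IH => i; rewrite cat_rcons; exact: hs.
Qed.

(** A lift of a member of the proper ideal m' is no unit, so it lies in m. *)
Lemma seq_lift (m' : ideal S) (m : ideal R) (s : seq S) : local_noeth m -> maximal_ideal m' ->
  [set` s] `<=` (m' : set S) -> exists t, map pi t = s /\ forall x, x \in t -> m x.
Proof.
move=> lR [m'1 _]; elim: s => [|u s IH] hs; first by exists [::].
have [|t [et mt]] := IH; first by move=> v vs; apply: hs; rewrite /= inE vs orbT.
have [x ex] := pi_surj u; exists (x :: t); split=> [|y]; first by rewrite /= ex et.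
rewrite inE => /predU1P[->|/mt//]; apply: contrapT => /(ln_unit lR)[z zx].
apply: m'1; apply/mem_one; rewrite -(rmorph1 pi) -zx rmorphM ex; apply: idealMl.
by apply: hs; rewrite /= inE eqxx.
Qed.

End Surjection.

Section QuotientMorphism.
Variables (R : comPzRingType) (J : ideal R).

Lemma quot_pi_additive : additive (quot_pi J : R -> quot_ring J).
Proof. by move=> x y; exact: (raddfB \pi_(Quotient.quot (ideal_pred J))). Qed.

Lemma quot_pi_monoid : monoid_morphism (quot_pi J : R -> quot_ring J).
Proof. by split=> // x y; exact: quot_piM. Qed.

HB.instance Definition _ := GRing.isAdditive.Build R (quot_ring J) (quot_pi J) quot_pi_additive.
HB.instance Definition _ := GRing.isMonoidMorphism.Build R (quot_ring J) (quot_pi J) quot_pi_monoid.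

Lemma quot_pi_ker x : quot_pi J x = 0 <-> J x.
Proof. by rewrite -(rmorph0 (quot_pi J)) quot_pi_eq subr0. Qed.

Lemma quot_idealE (I : ideal R) : quot_ideal J I = extI (quot_pi J) I.
Proof.
apply: ideal_le_anti; first by move=> _ [x Ix <-]; exact: ext_mem.
by apply/ext_le => x Ix; exists x.
Qed.

End QuotientMorphism.

Lemma has_length_uniq (R : comPzRingType) l l' : has_length R l -> has_length R l' -> l = l'.
Proof. by move=> [c h] [c' h']; apply/eqP; rewrite eqn_leq h// h'. Qed.

Lemma krull_dim_uniq (R : comPzRingType) l l' : has_krull_dim R l -> has_krull_dim R l' -> l = l'.
Proof. by move=> [c h] [c' h']; apply/eqP; rewrite eqn_leq h// h'. Qed.

Lemma krull_dimE (R : comPzRingType) n : has_krull_dim R n -> krull_dim R = n.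
Proof.
move=> h; rewrite /krull_dim; case: xgetP => [_ -> h'|/(_ n)//]; exact: krull_dim_uniq h' h.
Qed.

Lemma ring_lengthE (R : comPzRingType) n : has_length R n -> ring_length R = n.
Proof.
move=> h; rewrite /ring_length; case: xgetP => [_ -> h'|/(_ n)//]; exact: has_length_uniq h' h.
Qed.

Lemma quot_ring_length (R : comPzRingType) (m J : ideal R) n l : local_noeth m ->
  has_len m (J + m ^+ n) l -> ring_length (quot_ring (ideal_exp (quot_ideal J m) n)) = l.
Proof.
move=> lR hl; apply: ring_lengthE; rewrite ideal_expE quot_idealE -extX.
apply: (has_length_surj (pi := quot_pi _ \o quot_pi J) _ _ lR hl) => [u|x].
  have [v <-] := quot_pi_surj u; have [x <-] := quot_pi_surj v; by exists x.
rewrite /= quot_pi_ker; apply: ext_surjP; [exact: quot_pi_surj|exact: quot_pi_ker].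
Qed.

Lemma leq_exp_ffact n d : (n.+1 ^ d <= (n + d) ^_ d)%N.
Proof.
elim: d => [//|d IH]; rewrite addnS ffactSS expnS; apply: leq_mul IH.
by rewrite ltnS leq_addr.
Qed.

Lemma ffact_leq_exp n d : (n ^_ d <= n ^ d)%N.
Proof.
elim: d n => [//|d IH] n; case: n => [|n]; first by rewrite ffact0n.
rewrite ffactSS expnS; apply: leq_mul => //; apply: leq_trans (IH n) _.
by apply: leq_expr_r.
Qed.

(** As d! C(k + d, d) is between (k + 1)^d and (k + d)^d, the sequence is squeezed between e (1 -
    c/n)^d and e (1 + d/n)^d. *)
Lemma limn_binomial_growth (L : nat -> nat) e c d :
  (forall n, (L n.+1 <= e * 'C(n + d, d))%N) ->
  (forall n, (e * 'C(n + d, d) <= L (n.+1 + c))%N) ->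
  limn (fun n => (d`! * L n)%:R / n%:R ^+ d : rat^o) = e%:R.
Proof.
move=> up low; apply: (@limn_squeeze_poly rat _ (- c%:R) d%:R _ d).
near=> n.
have ngtc : (c < n)%N by near: n; exact: nbhs_infty_gt.
have n0 : (0 < n)%N by exact: leq_ltn_trans ngtc.
have nr0 : (n%:R : rat) != 0 by rewrite pnatr_eq0 -lt0n.
have npos : 0 < (n%:R : rat) ^+ d by rewrite exprn_gt0// ltr0n.
have E q : (1 + q * n%:R^-1) ^+ d * n%:R ^+ d = (n%:R + q) ^+ d :> rat.
  by rewrite -exprMn mulrDl mul1r -mulrA mulVf// mulr1.
rewrite ler_pdivlMr// ler_pdivrMr// -!mulrA !E.
rewrite -natrB 1?ltnW// -natrD -!natrX -!natrM !ler_nat; apply/andP; split.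
  have := low (n - c.+1)%N; have -> : ((n - c.+1).+1 + c = n)%N by lia.
  move=> h; rewrite mulnC [X in (_ <= X)%N]mulnC; apply: leq_trans (leq_mul h (leqnn d`!)).
  rewrite -mulnA bin_ffact mulnC leq_mul2l; apply/orP; right.
  by apply: leq_trans (leq_exp_ffact _ _); apply: leq_expr_r; lia.
have := up n.-1; rewrite prednK// => h; rewrite mulnC.
apply: leq_trans (leq_mul h (leqnn d`!)) _; rewrite -mulnA bin_ffact leq_mul2l; apply/orP; right.
apply: leq_trans (ffact_leq_exp _ _) _; apply: leq_expr_r; lia.
Unshelve. all: by end_near. Qed.

(* Over some A(T_1, ..., T_k) the ideal m has a reduction F generated modulo J by a *)
(* regular sequence, and then the multiplicity of A/J is the length of A/(J + F). *)
Lemma multiplicity_cm (R : comPzRingType) (m J : ideal R) t d : local_noeth m ->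
  has_krull_dim (quot_ring J) d -> dim_le J d -> regseq J t -> size t = d ->
  (forall x, x \in t -> m x) -> exists e, multiplicity (quot_ideal J m) = e%:R /\
  forall n l, has_len m (J + m ^+ n.+1) l -> (l <= e * 'C(n + d, d))%N.
Proof.
move=> lR hd dimJ rt st mt.
have [B [phi [s [c [ge ss ms red]]]]] := reduction_exists lR (growth_dim lR dimJ).
have lB := ge_ln ge.
have dB : depth_ge d (extI phi m) (extI phi J).
  rewrite -st -(size_map phi); apply: depth_regseq => //; last exact: (ge_regseq ge).
  by move=> _ /mapP[x /mt mx ->]; exact: ext_mem.
have red1 := red 1%N; rewrite expr1 in red1.
have [e he] := has_len_exists lB red1.
have hlen := sop_length lB _ dB ss ms red1 he.
have up n l : has_len m (J + m ^+ n.+1) l -> (l <= e * 'C(n + d, d))%N.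
  move=> /(ge_len lR ge); rewrite extD extX; apply: (has_len_le lB _ (hlen n)).
  apply: ileD2 => //; apply: ileX2; exact/spans_le.
exists e; split=> //.
have [L hL] := choice (len_exists lR J).
rewrite /multiplicity (krull_dimE hd).
under eq_fun do rewrite (quot_ring_length lR (hL _)).
apply: (limn_binomial_growth (c := c)) => n; first exact: up.
have := ge_len lR ge (hL (n.+1 + c)%N); rewrite extD extX => h.
apply: (has_len_le lB _ h (hlen n)); apply: ileD; [exact: ileDl|exact: red].
Qed.

(** * Approximating a parameter *)

Lemma regseq_take (R : comPzRingType) (J : ideal R) n s : regseq J s -> regseq J (take n s).
Proof. by elim: s n J => [|a s IH] [|n] J //= [ra /IH h]; split. Qed.

(* If L = K + L inter (s) and s is regular modulo L, then L = K + s L. *)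
Lemma sop_cancel N (A : comPzRingType) (m K L : ideal A) s r : local_noeth m ->
  depth_ge N m L -> size s = N -> (forall x, x \in s -> m x) -> m ^+ r <<= L + spans s ->
  L <<= K + spans s -> K <<= L -> L <<= K.
Proof.
move=> lA; elim: N K L s => [|N IH] K L [|a s] //= dL.
  by rewrite spans_nil !addr0.
rewrite spans_cons !addrA => -[ss] ms mr LK KL.
have ma : m a by apply: ms; exact: mem_head.
have {}ms x : x \in s -> m x by move=> xs; apply: ms; rewrite inE xs orbT.
have ra : regular L a by apply: sop_regular dL ss ma ms mr.
have LKa : L + prin a <<= K + prin a.
  apply: (IH _ _ s) => //; first exact: depth_exchange.
    by apply: ileD => //; apply: ile_trans (@ileDl _ _ _); exact: ileDr.
  exact: ileD2.
(* Here x = k + t a with k in K, so t a is in L, and t is in L by regularity of a. *)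
apply: (nakayama_eq lA ma) => x Lx; have /memDprin[t Kt] := LKa x (@ileDl _ _ _ x Lx).
rewrite -[x](subrK (t * a)); apply: memD2 => //; rewrite [t * a]mulrC.
apply: ideal_mul_mem; first exact: prin_mem.
by apply: ra; have := idealB Lx (KL _ Kt); congr (L _); ring.
Qed.

Lemma ideal_addX_le (R : comPzRingType) (m I J : ideal R) p a : (p <= a)%N ->
  I + m ^+ a = J + m ^+ a -> I + m ^+ p = J + m ^+ p.
Proof.
move=> lepa e; have E K : K + m ^+ p = K + m ^+ a + m ^+ p.
  by rewrite -addrA [m ^+ a + _]addrC (@ile_add_sub _ (m ^+ p))//; exact: ileXX.
by rewrite E e -E.
Qed.

(** After multiplication by N! the left side is at most E N! (c + N)^N (n + 1)^(N-1) = n (n +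
    1)^(N-1), which is below (n + 1)^N. *)
Lemma binomial_growth_gap E c N : exists n, forall d, (d < N)%N ->
  (E * 'C(n + c + d, d) < 'C(n + N, N))%N.
Proof.
exists (E * N`! * (c + N) ^ N)%N => d ltdN; set n := (E * _ * _)%N.
have N0 : (0 < N)%N by exact: leq_ltn_trans ltdN.
rewrite -(ltn_pmul2r (fact_gt0 N)) bin_ffact; apply: leq_trans (leq_exp_ffact n N).
have h1 : ('C(n + c + d, d) <= ((c + N) * n.+1) ^ N.-1)%N.
  have h : ('C(n + c + d, d) <= (n + c + d) ^ d)%N.
    by apply: leq_trans (ffact_leq_exp _ _); rewrite -bin_ffact leq_pmulr// fact_gt0.
  apply: leq_trans h _.
  have h : (n + c + d <= (c + N) * n.+1)%N by nia.
  apply: leq_trans (leq_expr_r d h) _; apply: leq_pexp2l; first by rewrite muln_gt0 addn_gt0 N0 orbT.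
  by lia.
rewrite mulnAC; apply: leq_ltn_trans (leq_mul (leqnn _) h1) _.
rewrite -(prednK N0) [in X in (_ < X)%N]expnS /= expnMn mulnA ltn_pmul2r ?expn_gt0//.
rewrite ltnS /n (prednK N0) leq_mul2l; apply/orP; right.
by apply: leq_pexp2l; rewrite ?addn_gt0 ?N0 ?orbT// leq_pred.
Qed.

(** By [prime_chain_regular] every chain of primes over (x) can be prolonged downwards. *)
Lemma nonunit_invertible_dim (R : comPzRingType) (m : ideal R) x d : local_noeth m ->
  dim_le (0 : ideal R) d -> m x -> regular 0 x -> exists2 N, d = N.+1 & dim_le (prin x) N.
Proof.
move=> lR d0 mx rx.
have up l : prime_chain (prin x) l -> (l.+1 <= d)%N.
  by move=> h; apply: d0; apply: (prime_chain_regular lR rx); rewrite add0r.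
case: d d0 up => [|N] d0 up; last by exists N.
suff /up : prime_chain (prin x) 0 by [].
by exists (fun=> m); split=> // i _; split; [exact: prime_m|apply/prin_le].
Qed.

Section Approximation.
Variables (R : comPzRingType) (m : ideal R) (x : R) (N : nat) (s0 : seq R).
Hypothesis lR : local_noeth m.
Hypotheses (regs0 : regseq 0 s0) (ms0 : forall y, y \in s0 -> m y) (sizes0 : size s0 = N.+1).
Hypotheses (mx : m x) (regx : regular 0 x).
Variables (B : comPzRingType) (phi : {rmorphism R -> B}) (xs : seq B) (c : nat).
Hypotheses (ge : good_ext phi m) (size_xs : size xs = N).
Hypotheses (mxs : forall y, y \in xs -> extI phi m y).
Hypothesis red : forall i, extI phi m ^+ (i + c) <<= extI phi (prin x) + spans xs ^+ i.

Let lB := ge_ln ge.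

Lemma depth_base : depth_ge N.+1 (extI phi m) 0.
Proof.
rewrite -(ext0 phi) -sizes0 -(size_map phi); apply: depth_regseq => //; last exact: (ge_regseq ge).
by move=> _ /mapP[y /ms0 my ->]; exact: ext_mem.
Qed.

Lemma red1 : extI phi m ^+ c.+1 <<= prin (phi x) + spans xs.
Proof. by have := @red 1%N; rewrite ext_prin expr1. Qed.

(** B/(x) has depth at least N by [depth_exchange], so [sop_length] computes the lengths for powers
    of xs, with e at least 1; and m^(n+1+c) lies in (x) + (xs)^(n+1). *)
Lemma length_lower n l : has_len m (prin x + m ^+ (n.+1 + c)) l -> ('C(n + N, N) <= l)%N.
Proof.
move=> /(ge_len lR ge); rewrite extD extX => hl.
have rX : regular 0 (phi x) by rewrite -(ext0 phi); exact: (ge_regular ge).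
have dX : depth_ge N (extI phi m) (prin (phi x)).
  by rewrite -[prin _]add0r; apply: (depth_exchange lB depth_base) => //; exact: ext_mem.
have [e he] := has_len_exists lB red1.
have e0 : (0 < e)%N.
  apply: (has_len_gt0 _ he) => h; apply: (ln_proper lB); move: h; apply: ileD; last exact/spans_le.
  by apply/prin_le; exact: ext_mem.
have := has_len_le lB _ hl (sop_length lB n dX size_xs mxs red1 he).
move=> /(_ _)/leq_trans h; rewrite -ext_prin in h *.
apply: leq_trans (leq_pmull _ e0) (h _ _ (leqnn _)); apply: ileD; [exact: ileDl|exact: red].
Qed.

(** Write x = y + z with y in J and z in m^a. By Nakayama's lemma V = (y) + (xs) contains W = (x) +
    (xs), hence J, and [sop_cancel] yields J = (y). Then y and xs are N + 1 parameters in B, so y is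
    regular. *)
Lemma approximation_principal (J : ideal R) t a : regseq J t -> (forall y, y \in t -> m y) ->
  (N <= size t)%N -> (c.+1 < a)%N -> prin x + m ^+ a = J + m ^+ a ->
  exists2 y, regular 0 y & J = prin y.
Proof.
move=> rt mt leNt ltca e.
have [y [z [Jy mz xyz]]] : x \ini J + m ^+ a by rewrite -e; apply: ileDl; exact: prin_mem.
pose W := prin (phi x) + spans xs; pose V := prin (phi y) + spans xs.
(* The strict bound c + 1 < a leaves the factor m for Nakayama's lemma. *)
have maW : extI phi m ^+ a <<= extI phi m * W.
  apply: (@ile_trans _ _ (extI phi m ^+ c.+2)); first exact: ileXX.
  by rewrite exprS; apply: ileM2 => //; exact: red1.
have WV : W <<= V.
  apply: (nakayama lB); apply: ileD; last by apply: ile_trans (@ileDl _ _ _); exact: ileDr.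
  apply/prin_le; rewrite xyz rmorphD; apply: memD2; first by apply: ileDl; exact: prin_mem.
  by apply: maW; rewrite -extX; exact: ext_mem.
have JV : extI phi J <<= V.
  apply: ile_trans WV; apply: (@ile_trans _ _ (extI phi (prin x + m ^+ a))).
    by rewrite e; apply: ext_mono; exact: ileDl.
  rewrite extD ext_prin extX; apply: ileD; first exact: ileDl.
  by apply: ile_trans maW _; exact: ileMl.
have redV : extI phi m ^+ c.+1 <<= V by exact: ile_trans red1 WV.
have yJ : prin y <<= J by apply/prin_le.
have my : m y.
  have -> : y = x - z by rewrite xyz addrK.
  by apply: idealB => //; move: mz; rewrite -(subnKC (ltnW ltca)) exprD exprS -mulrA; exact: ileMr.
have dJ : depth_ge N (extI phi m) (extI phi J).
  have st : size (map phi (take N t)) = N by rewrite size_map size_takel.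
  rewrite -{1}st; apply: depth_regseq => //; last by apply: (ge_regseq ge); exact: regseq_take.
  by move=> _ /mapP[u /mem_take/mt mu ->]; exact: ext_mem.
have JyE : extI phi J <<= prin (phi y).
  apply: (sop_cancel lB dJ size_xs mxs (r := c.+1)) => //.
    by apply: ile_trans redV _; apply: ileD2 => //; apply/prin_le; exact: ext_mem.
  by apply/prin_le; exact: ext_mem.
have eJ : J = prin y.
  by apply: ideal_le_anti => //; apply: (ge_faithful_le lR ge); rewrite ext_prin.
exists y => // u yu.
have ry : regular 0 (phi y).
  apply: (sop_regular lB depth_base size_xs (ext_mem my) mxs (r := c.+1)).
  by rewrite add0r.
apply: (ge_faithful lR ge); rewrite ext0; apply: ry.
by rewrite -(ext0 phi) -rmorphM; exact: ext_mem.
Qed.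

End Approximation.

Theorem corollary1p4 (R : comPzRingType) (m : ideal R)
    (hR : local_cohen_macaulay m)
    (I : ideal R) (hI : invertible_ideal I) :
  exists a : nat, (0 < a)%N /\
    forall J : ideal R,
      cohen_macaulay (quot_ring J) ->
      multiplicity (quot_ideal J m) <= multiplicity (quot_ideal I m) ->
      ideal_add I (ideal_exp m a) = ideal_add J (ideal_exp m a) ->
      invertible_ideal J.
Proof.
have [nR locR [d hd [[s0 [regs0 ms0 size_s0]] _]]] := hR.
have lR := local_ring_noeth nR locR.
have [x nzx eI] := hI; rewrite -/(prin x) in eI.
have regx : regular 0 x by move=> y /nzx.
(* If x is a unit, a = 1 suffices: 1 in J + m forces J to be the unit ideal. *)
have [mx|/(ln_unit lR)[u ux]] := pselect (m x); last first.
  exists 1%N; split=> // J _ _; rewrite ideal_expE => e.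
  have : (1 : R) \ini J + m ^+ 1.
    by rewrite -[J + _]e eI; apply: ileDl; rewrite -ux; apply: idealMl; exact: prin_mem.
  rewrite expr1 => -[j [z [Jj mz e1]]].
  have [v vz] := ln_1B lR mz.
  have J1 : J 1 by rewrite -vz e1 addrK; exact: idealMl.
  exists 1; first by move=> y; rewrite mul1r.
  by rewrite (_ : J = 1); [apply/esym/mem_one; exact: prin_mem|apply/mem_one].
(* R is viewed as its own quotient by the zero ideal. *)
have idR (y : R) : exists z, (idfun : R -> R) z = y by exists y.
have kerR (y : R) : (idfun : R -> R) y = 0 <-> (0 : ideal R) y by [].
have dim0 : dim_le (0 : ideal R) d by exact: (dim_le_surj idR kerR hd).
have rs0 : regseq 0 s0.
  by have := regseq_surj idR kerR (s1 := [::]) (s2 := s0); rewrite map_id spans_nil addr0; apply.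
have [N dN dimx] := nonunit_invertible_dim lR dim0 mx regx; rewrite {}dN in hd size_s0 dim0.
have [B [phi [xs [c [ge size_xs mxs red]]]]] := reduction_exists lR (growth_dim lR dimx).
have [E hE] : exists E, multiplicity (quot_ideal I m) <= E%:R.
  exists (Num.Def.archi_bound `|multiplicity (quot_ideal I m)|).
  by apply: le_trans (ler_norm _) (ltW (archi_boundP (normr_ge0 _))).
have [n hn] := binomial_growth_gap E c N.
(* Lengths are compared at exponent n + 1 + c; the extra 1 ensures c + 1 < a even for n = 0. *)
exists (n.+1 + c).+1; split=> // J hJ hmult; rewrite !ideal_expE eI => e.
have {}e : prin x + m ^+ (n.+1 + c).+1 = J + m ^+ (n.+1 + c).+1 := e.
have Jm : J <<= m.
  apply: (@ile_trans _ _ (prin x + m ^+ (n.+1 + c).+1)); first by rewrite e; exact: ileDl.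
  by apply: ileD; [exact/prin_le|rewrite exprS; exact: ileMr].
case: hJ => [J1|[m' [nQ [maxm' _] [del hdel [[s [regs ms size_s]] _]]]]].
  case: (ln_proper lR); apply: Jm; apply/quot_pi_ker; exact: J1.
have [t [et mt]] := seq_lift (@quot_pi_surj R J) lR maxm' ms.
have rt : regseq J t.
  have := regseq_surj (@quot_pi_surj R J) (@quot_pi_ker R J) (s1 := [::]) (s2 := t).
  by rewrite et spans_nil addr0; apply.
have st : size t = del by rewrite -size_s -et size_map.
have dimJ := dim_le_surj (@quot_pi_surj R J) (@quot_pi_ker R J) hdel.
(* If del < N, the length modulo J + m^(n+1+c) is at most E C(n + c + del, del) < C(n + N, N),
   although it equals the length modulo I + m^(n+1+c). *)
have [leN|ltN] := leqP N del; last first.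
  have [eps [epsE epsle]] := multiplicity_cm lR hdel dimJ rt st mt.
  have [l hl] := len_exists lR (prin x) (n.+1 + c).
  have lower := length_lower lR rs0 ms0 size_s0 mx regx ge size_xs mxs red hl.
  rewrite (ideal_addX_le (leqnSn _) e) addSn in hl.
  have upper := epsle _ _ hl.
  have leE : (eps <= E)%N.
    by rewrite -(ler_nat rat) -epsE; exact: le_trans hmult hE.
  have := leq_trans lower (leq_trans upper (leq_mul leE (leqnn _))).
  by rewrite leqNgt hn.
have [||y ry ->] := approximation_principal lR rs0 ms0 size_s0 mx ge size_xs mxs red rt mt _ _ e.
- by rewrite st.
- by lia.
- by exists y => // z yz; apply: ry; rewrite yz; exact: idealr0.
Qed.
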